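(* Let $\mathcal O=\mathbb Z[\sqrt2]$, embedded in $\mathbb R$ in the usual way, and let $$A=\Bigl\{(a_n)_{n\geq0}\in\mathcal O^{\mathbb N}:\ \sup_n|a_n|<\infty\Bigr\},$$ a torsion-free abelian group under termwise addition. Let $F=K_{\mathbb Q}(A)$ and let $x,y$ be algebraically independent over $F$. Then, as abstract fields, $$F\cong F(x,y),\qquad F\not\cong F(x).$$
   Context: For a torsion-free abelian group $G$ (written additively), the rational group algebra $\mathbb Q[G]$ has the formal monomials $X^g$, $g\in G$, as a $\mathbb Q$-basis, with $X^gX^h=X^{g+h}$. It is an integral domain, and $K_{\mathbb Q}(G)=\operatorname{Frac}\mathbb Q[G]$ is its field of fractions. The absolute value in the definition of $A$ is the usual real absolute value, and the index set $\mathbb N$ is $\{0,1,2,\dots\}$. *)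

(* Defs.v *)
From HB Require Import structures.
From mathcomp Require Import all_boot all_order all_algebra finmap.
From mathcomp Require Import boolp classical_sets functions reals.
From mathcomp Require Import monalg.

Set Implicit Arguments.
Unset Strict Implicit.
Unset Printing Implicit Defensive.

Import Order.TTheory GRing.Theory Num.Theory.

Local Open Scope ring_scope.

HB.mixin Record Zmodule_isTorsionFree V of GRing.Zmodule V := {
  mulrSn_tf : forall (n : nat) (x : V), x *+ n.+1 = 0 -> x = 0
}.

#[short(type="tfZmodType")]
HB.structure Definition TorsionFreeZmodule :=
  { V of GRing.Zmodule V & Zmodule_isTorsionFree V }.

(* The module underlying [{malg R[G]}] (finitely supported functions G -> R,
   with [<< c *g g >>] for c X^g) is reused as is.  The ring structure of
   [{malg R[G]}] is not available here, since it requires a [monomType], in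
   which x y = 1 forces x = y = 1; hence the alias and the product below. *)
Definition grpalg (R : nzRingType) (G : zmodType) : Type := {malg R[G]}.

Section GroupAlgebraRing.
Context (R : nzRingType) (G : zmodType).
Implicit Types (f g h : {malg R[G]}) (k : G).

Local Open Scope fset_scope.

Definition ga_one : {malg R[G]} := << 1 *g 0%R >>.

Definition ga_mul f g : {malg R[G]} :=
  \sum_(k1 <- msupp f) \sum_(k2 <- msupp g) << f@_k1 * g@_k2 *g (k1 + k2)%R >>.

Lemma ga_mulw (d1 d2 : {fset G}) f g :
  msupp f `<=` d1 -> msupp g `<=` d2 ->
  ga_mul f g =
    \sum_(k1 <- d1) \sum_(k2 <- d2) << f@_k1 * g@_k2 *g (k1 + k2)%R >>.
Proof.
move=> le_d1 le_d2; rewrite /ga_mul (big_fset_incl _ le_d1) /=.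
  apply/eq_bigr=> k1 _; apply/big_fset_incl => // k _ /mcoeff_outdom ->.
  by rewrite mulr0 monalgU0.
move=> k _ /mcoeff_outdom fk.
by rewrite big1 => // k' _; rewrite fk mul0r monalgU0.
Qed.

Lemma ga_mul0g : left_zero 0 ga_mul.
Proof. by move=> g; rewrite /ga_mul msupp0 big_seq_fset0. Qed.

Lemma ga_mulg0 : right_zero 0 ga_mul.
Proof.
by move=> g; rewrite /ga_mul big1 // => k _; rewrite msupp0 big_seq_fset0.
Qed.

Lemma ga_mulUg c k g :
  ga_mul << c *g k >> g = \sum_(k' <- msupp g) << c * g@_k' *g (k + k')%R >>.
Proof.
rewrite (ga_mulw msuppU_le (fsubset_refl _)) big_seq_fset1.
by apply/eq_bigr => k' _; rewrite mcoeffUU.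
Qed.

Lemma ga_mulgU c k g :
  ga_mul g << c *g k >> = \sum_(k' <- msupp g) << g@_k' * c *g (k' + k)%R >>.
Proof.
rewrite (ga_mulw (fsubset_refl _) msuppU_le).
by apply/eq_bigr => k' _; rewrite big_seq_fset1 mcoeffUU.
Qed.

Lemma ga_mulUU (c1 c2 : R) k1 k2 :
  ga_mul << c1 *g k1 >> << c2 *g k2 >> = << c1 * c2 *g (k1 + k2)%R >>.
Proof. by rewrite (ga_mulw msuppU_le msuppU_le) !big_seq_fset1 !mcoeffUU. Qed.

Lemma ga_mulEl f g :
  ga_mul f g = \sum_(k <- msupp f) ga_mul << f@_k *g k >> g.
Proof. by apply/eq_bigr=> k _; rewrite ga_mulUg. Qed.

Lemma ga_mulEr f g :
  ga_mul f g = \sum_(k <- msupp g) ga_mul f << g@_k *g k >>.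
Proof.
by rewrite {1}/ga_mul exchange_big; apply/eq_bigr=> k _; rewrite ga_mulgU.
Qed.

Lemma ga_mul1g : left_id ga_one ga_mul.
Proof.
move=> g; rewrite ga_mulUg [RHS]monalgE.
by apply/eq_bigr=> k _; rewrite mul1r add0r.
Qed.

Lemma ga_mulg1 : right_id ga_one ga_mul.
Proof.
move=> g; rewrite ga_mulgU [RHS]monalgE.
by apply/eq_bigr=> k _; rewrite mulr1 addr0.
Qed.

Lemma ga_mulDl : left_distributive ga_mul +%R.
Proof.
move=> f1 f2 g.
rewrite (ga_mulw (msuppD_le _ _) (fsubset_refl _)).
rewrite (ga_mulw (fsubsetUl _ (msupp f2)) (fsubset_refl _)).
rewrite (ga_mulw (fsubsetUr (msupp f1) _) (fsubset_refl _)).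
rewrite -big_split /=; apply/eq_bigr=> k1 _.
rewrite -big_split /=; apply/eq_bigr=> k2 _.
by rewrite mcoeffD mulrDl monalgUD.
Qed.

Lemma ga_mulDr : right_distributive ga_mul +%R.
Proof.
move=> f g1 g2.
rewrite (ga_mulw (fsubset_refl _) (msuppD_le _ _)).
rewrite (ga_mulw (fsubset_refl _) (fsubsetUl _ (msupp g2))).
rewrite (ga_mulw (fsubset_refl _) (fsubsetUr (msupp g1) _)).
rewrite -big_split /=; apply/eq_bigr=> k1 _.
rewrite -big_split /=; apply/eq_bigr=> k2 _.
by rewrite mcoeffD mulrDr monalgUD.
Qed.

Lemma ga_mulA : associative ga_mul.
Proof.
move=> f g h.
rewrite [RHS](big_morph (ga_mul^~ _) (fun _ _ => ga_mulDl _ _ _) (ga_mul0g _)).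
rewrite ga_mulEl; apply/eq_bigr=> k1 _.
rewrite [LHS](big_morph (ga_mul _) (fun _ _ => ga_mulDr _ _ _) (ga_mulg0 _)).
rewrite [RHS](big_morph (ga_mul^~ _) (fun _ _ => ga_mulDl _ _ _) (ga_mul0g _)).
apply/eq_bigr=> k2 _.
rewrite [LHS](big_morph (ga_mul _) (fun _ _ => ga_mulDr _ _ _) (ga_mulg0 _)).
by rewrite ga_mulEr; apply/eq_bigr=> k3 _; rewrite !ga_mulUU mulrA addrA.
Qed.

Lemma ga_one_neq0 : ga_one != 0.
Proof. by rewrite monalgU_eq0 oner_eq0. Qed.

HB.instance Definition _ := GRing.Lmodule.copy (grpalg R G) {malg R[G]}.
HB.instance Definition _ := GRing.Zmodule_isNzRing.Build (grpalg R G)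
  ga_mulA ga_mul1g ga_mulg1 ga_mulDl ga_mulDr ga_one_neq0.

Lemma mcoeff_ga_mul f g k :
  (ga_mul f g)@_k = \sum_(k1 <- msupp f) \sum_(k2 <- msupp g)
    (f@_k1 * g@_k2) *+ (k1 + k2 == k)%R.
Proof.
rewrite raddf_sum; apply/eq_bigr=> k1 _; rewrite raddf_sum.
by apply/eq_bigr=> k2 _; rewrite /= mcoeffU.
Qed.

End GroupAlgebraRing.

Definition gaX (R : nzRingType) (G : zmodType) (g : G) : grpalg R G :=
  << 1 *g g >>.

Lemma gaX0 (R : nzRingType) (G : zmodType) : gaX R (0 : G) = 1.
Proof. by []. Qed.

Lemma gaXD (R : nzRingType) (G : zmodType) (g h : G) :
  gaX R (g + h) = gaX R g * gaX R h.
Proof. by rewrite [RHS]ga_mulUU mulr1. Qed.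

Section GroupAlgebraComUnitRing.
Context (R : comNzRingType) (G : zmodType).
Implicit Types (f g : grpalg R G).

Lemma ga_mulC : commutative (@GRing.mul (grpalg R G)).
Proof.
move=> f g; rewrite /GRing.mul /= /ga_mul exchange_big.
by apply/eq_bigr=> k1 _; apply/eq_bigr=> k2 _; rewrite mulrC addrC.
Qed.

HB.instance Definition _ :=
  GRing.PzRing_hasCommutativeMul.Build (grpalg R G) ga_mulC.

(* Units and inverses are obtained by choice. *)
Definition ga_unit : {pred grpalg R G} := [pred f | `[< exists g, g * f = 1 >]].

Definition ga_inv f : grpalg R G :=
  if pselect (exists g, g * f = 1) is left ex then projT1 (cid ex) else f.

Lemma ga_mulVf : {in ga_unit, left_inverse 1 ga_inv *%R}.
Proof.
by move=> f /asboolP ex; rewrite /ga_inv; case: pselect => // ?; case: cid.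
Qed.

Lemma ga_unitPl f g : g * f = 1 -> f \in ga_unit.
Proof. by move=> gf1; apply/asboolP; exists g. Qed.

Lemma ga_inv_out : {in [predC ga_unit], ga_inv =1 id}.
Proof.
by move=> f /asboolP nex; rewrite /ga_inv; case: pselect => // /nex.
Qed.

HB.instance Definition _ := GRing.ComNzRing_hasMulInverse.Build (grpalg R G)
  ga_mulVf ga_unitPl ga_inv_out.

End GroupAlgebraComUnitRing.

Section TorsionFreeOrder.
Context (G : tfZmodType).

(* On a torsion-free group, any finite set of nonzero elements is made of
   elements that are positive or negative for some translation-invariant strict
   order. *)
Lemma tf_positive (s : seq G) : 0 \notin s -> exists P : G -> Prop,
  [/\ forall x y, P x -> P y -> P (x + y), ~ P 0 &
      forall x, x \in s -> P x \/ P (- x)].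
Proof.
elim: s => [_|d s IHs]; first by exists (fun=> False); split.
rewrite inE negb_or eq_sym => /andP[d0 /IHs[P [PD P0 Ps]]].
have PMn x n : P x -> P (x *+ n.+1).
  by move=> Px; elim: n => // n IHn; rewrite mulrS; exact: PD.
pose Q e x := exists (m : nat) (p : G),
  [/\ p = 0 \/ P p, x = p + e *+ m & (0 < m)%N \/ P p].
have QD e x y : Q e x -> Q e y -> Q e (x + y).
  move=> [m [p [p0 -> mp]]] [n [q [q0 -> nq]]]; exists (m + n)%N, (p + q).
  split; last 1 first.
  - case: mp => [m_gt0|Pp]; first by left; rewrite addn_gt0 m_gt0.
    by case: q0 => [->|Pq]; right; rewrite ?addr0 //; exact: PD.
  - case: p0 q0 => [->|Pp] [->|Pq]; rewrite ?addr0 ?add0r; [by left|by right..|].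
    by right; exact: PD.
  - by rewrite mulrnDr addrACA.
have PQ e x : P x -> Q e x.
  by move=> Px; exists 0%N, x; rewrite mulr0n addr0; split=> //; right.
have Qe e : Q e e.
  by exists 1%N, 0; rewrite add0r mulr1n; split=> //; left.
have Q0 e : e != 0 -> Q e 0 -> exists m p, P p /\ p = - (e *+ m.+1).
  move=> e0 [[|m] [p [p0 def0 mp]]].
    by case: mp => // Pp; case: P0; rewrite def0 mulr0n addr0.
  exists m, p; split; last by apply/eqP; rewrite -addr_eq0 -def0.
  case: p0 => // p0; move: def0; rewrite p0 add0r => /esym /mulrSn_tf e_eq0.
  by rewrite e_eq0 eqxx in e0.
have [Qd0|nQd0] := pselect (Q d 0); last first.
  exists (Q d); split=> // [x y|x]; first exact: QD.
  rewrite inE => /orP[/eqP->|/Ps[]]; [by left|by left; apply: PQ|].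
  by right; apply: PQ.
exists (Q (- d)); split=> [x y||x]; first exact: QD; last first.
  rewrite inE => /orP[/eqP->|/Ps[]]; [by right|by left; apply: PQ|].
  by right; apply: PQ.
have [m [p [Pp def_p]]] := Q0 d d0 Qd0.
move/Q0; rewrite oppr_eq0 => /(_ d0)[n [q [Pq def_q]]].
apply: P0; rewrite (_ : 0 = p *+ n.+1 + q *+ m.+1).
  by apply: PD; exact: PMn.
by rewrite def_p def_q !mulNrn opprK -!mulrnA mulnC addNr.
Qed.

Lemma tf_max (P : G -> Prop) (s : seq G) :
  (forall x y, P x -> P y -> P (x + y)) ->
  {in s &, forall x y, x != y -> P (x - y) \/ P (y - x)} -> s != [::] ->
  exists2 m, m \in s & {in s, forall x, x = m \/ P (m - x)}.
Proof.
move=> PD; elim: s => // a s IHs Ps _.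
have [->|s0] := eqVneq s [::].
  by exists a; rewrite ?mem_head // => x; rewrite inE => /eqP ->; left.
have [x y xs ys|m ms mP] := IHs _ s0.
  by apply: Ps; rewrite inE ?xs ?ys orbT.
have [<-|am] := eqVneq m a.
  exists m; rewrite ?mem_head // => x; rewrite inE => /orP[/eqP->|/mP//].
  by left.
have m_as : m \in a :: s by rewrite inE ms orbT.
have [Pma|Pam] := Ps m a m_as (mem_head _ _) am.
  by exists m => // x; rewrite inE => /orP[/eqP->|/mP//]; right.
exists a; rewrite ?mem_head // => x; rewrite inE => /orP[/eqP->|/mP[->|Pmx]].
- by left.
- by right.
- by right; rewrite -(subrKA m); exact: PD.
Qed.

End TorsionFreeOrder.

Section GroupAlgebraDomain.
Context (R : idomainType) (G : tfZmodType).

Lemma ga_integral : GRing.integral_domain_axiom (grpalg R G).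
Proof.
move=> f g fg0; apply/contraT; rewrite negb_or => /andP[f0 g0].
have supp_neq0 (h : {malg R[G]}) : h != 0 -> (msupp h : seq G) != [::].
  apply: contra_neq => h0; apply/malgP => k; rewrite mcoeff0.
  by apply: mcoeff_outdom; rewrite -[k \in _]/(k \in (msupp h : seq G)) h0.
pose D (h : {malg R[G]}) := [seq x - y | x <- msupp h, y <- msupp h].
pose s := [seq x <- D f ++ D g | x != 0].
have [|P [PD P0 Ps]] := @tf_positive G s; first by rewrite mem_filter eqxx.
have Pcmp (h : {malg R[G]}) : {subset D h <= D f ++ D g} ->
    {in (msupp h : seq G) &, forall x y, x != y -> P (x - y) \/ P (y - x)}.
  move=> sub x y xh yh xy; rewrite -[y - x]opprB; apply: Ps.
  by rewrite mem_filter subr_eq0 xy sub //; apply/allpairsP; exists (x, y).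
have [||a af aP] := @tf_max G P (msupp f) PD; [|exact: supp_neq0|].
  by apply: Pcmp => x xD; rewrite mem_cat xD.
have [||b bg bP] := @tf_max G P (msupp g) PD; [|exact: supp_neq0|].
  by apply: Pcmp => x xD; rewrite mem_cat xD orbT.
have ab k1 k2 : k1 \in msupp f -> k2 \in msupp g ->
    k1 + k2 = a + b -> k1 = a /\ k2 = b.
  move=> /aP k1a /bP k2b e; have e0 : (a - k1) + (b - k2) = 0.
    by rewrite addrACA -opprD e subrr.
  case: k1a k2b e0 => [->|Pa] [->|Pb]; rewrite ?subrr ?add0r ?addr0 => e0 //.
  - by case: P0; rewrite -e0.
  - by case: P0; rewrite -e0.
  - by case: P0; rewrite -e0; exact: PD.
have /eqP := congr1 (mcoeff (a + b)) fg0.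
rewrite mcoeff0 [_ * _]/(ga_mul f g) mcoeff_ga_mul.
rewrite (big_fsetD1 a) //= (big_fsetD1 b) //= eqxx mulr1n.
rewrite [X in _ + X + _]big_seq big1 ?addr0; last first.
  move=> k2; rewrite in_fsetD1 => /andP[k2b k2g]; case: eqP => // /ab[]// _ e.
  by rewrite e eqxx in k2b.
rewrite [X in _ + X]big_seq big1 ?addr0; last first.
  move=> k1; rewrite in_fsetD1 => /andP[k1a k1f]; rewrite big_seq big1 // => k2 k2g.
  by case: eqP => // /ab[]// e _; rewrite e eqxx in k1a.
by rewrite mulf_eq0 !mcoeff_eq0 af bg.
Qed.

HB.instance Definition _ :=
  GRing.ComUnitRing_isIntegral.Build (grpalg R G) ga_integral.

End GroupAlgebraDomain.

Definition KQ (G : tfZmodType) : fieldType := {fraction (grpalg rat G)}.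

(* The rational function fields F(x) and F(x, y); F[x, y] is taken as F[x][y]. *)
Definition ratfun1 (F : fieldType) : fieldType := {fraction {poly F}}.
Definition ratfun2 (F : fieldType) : fieldType := {fraction {poly {poly F}}}.

Definition field_isomorphic (E F : fieldType) : Prop :=
  exists f : {rmorphism E -> F}, bijective f.

Section BoundedSequences.
Context (R : realType).

Definition Zsqrt2 : set R :=
  [set x | exists a b : int, x = a%:~R + b%:~R * Num.sqrt 2].

Definition bounded_Zsqrt2 : {pred nat -> R} :=
  [pred a | `[< (forall n, Zsqrt2 (a n)) /\
                has_ubound (range (fun n => `|a n|)) >]].

Lemma bounded_Zsqrt2_zmod_closed : zmod_closed bounded_Zsqrt2.
Proof.
split=> [|a a' /asboolP[aZ [M aM]] /asboolP[aZ' [M' aM']]]; apply/asboolP.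
  split=> [n|]; first by exists 0, 0; rewrite mul0r addr0.
  by exists 0 => _ [n _ <-]; rewrite normr0.
split=> [n|].
  have [p [q e]] := aZ n; have [p' [q' e']] := aZ' n.
  exists (p - p'), (q - q').
  by rewrite !intrB mulrBl addrACA -opprD -e -e'.
exists (M + M') => _ [n _ <-]; apply: le_trans (ler_normB _ _) _.
by apply: lerD; [apply: aM|apply: aM']; exists n.
Qed.

HB.instance Definition _ :=
  GRing.isZmodClosed.Build (nat -> R) bounded_Zsqrt2 bounded_Zsqrt2_zmod_closed.

Record bseq_Zsqrt2 := BSeqZsqrt2 {
  bseq_val :> nat -> R;
  _ : bseq_val \in bounded_Zsqrt2
}.

HB.instance Definition _ := [isSub for bseq_val].
HB.instance Definition _ := [Choice of bseq_Zsqrt2 by <:].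
HB.instance Definition _ := [SubChoice_isSubZmodule of bseq_Zsqrt2 by <:].

Lemma bseq_Zsqrt2_tf (n : nat) (a : bseq_Zsqrt2) : a *+ n.+1 = 0 -> a = 0.
Proof.
move=> /(congr1 bseq_val) an0; apply/val_inj/funext => i /=.
have /eqP : (val a *+ n.+1) i = 0 by rewrite -raddfMn /= an0.
by rewrite natmulfctE mulrn_eq0 => /eqP.
Qed.

HB.instance Definition _ :=
  Zmodule_isTorsionFree.Build bseq_Zsqrt2 bseq_Zsqrt2_tf.

End BoundedSequences.

(* Main.v *)
From HB Require Import structures.
Require Import Defs.
From mathcomp Require Import all_boot all_order all_algebra finmap.
From mathcomp Require Import boolp classical_sets reals.
From mathcomp Require Import monalg.
From mathcomp Require Import ring lra zify.

(** Let A be the group of bounded sequences, J its multiplication by sqrt 2, and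
    F the field of fractions of Q[A]. Below, monF e a is the monomial X^a and
    cstF e c the scalar c, seen in F.

    F and F(x, y) are isomorphic because the first entry of a sequence and the
    shift of the others identify A with Z ^ 2 + A: F is the field of fractions
    of the ring of Laurent polynomials in two variables over Q[A]
    (field_isomorphism).

    If F and F(x) were isomorphic, some dimension would be both even and odd.
    Let f : F -> F(x) be an isomorphism with inverse g, and let A_N be the
    subgroup of the sequences that vanish before place N.

    - g maps X^a to a monomial c X^(T a) for all a in some A_N. An element of F
      that is a quotient of polynomials with at most n terms is an n-th power
      only if it is a monomial, as in one variable a nonzero root has
      multiplicity less than the number of terms (sparse_power). Hence the
      multiplicative group of F modulo monomials behaves as one with a discrete
      norm. On the other hand A has many infinite sums whose remainders are
      divisible by large integers, and no homomorphism from A to such a group is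
      nonzero on all the A_N (discrete_gliding_hump, character_monomial_tail).

    - For N large, T commutes with J on A_N: the commutator D satisfies
      D J = - J D, so that it multiplies by the large - (sqrt 2 + 1) when its
      argument is multiplied by the small unit sqrt 2 - 1. This is incompatible
      with the boundedness of the values of D, unless D vanishes on some A_N
      (twisted_gliding_hump, tail_J_linear).

    - The derivations of F(x) that kill X^a for a in A_N form a space of
      dimension 2N + 1: they are dual to the 2N generators of A / A_N and to x.
      Through f and g they become the derivations of F that kill X^b for b in
      C = T(A_N), which are the additive maps from A / C to F. As C is stable
      under J, composition with J is an endomorphism of square 2 of a space of
      dimension 2N + 1 over F, and its determinant yields a square root of 2 in
      F. But F has none (even_derivations, no_isomorphism). *)

Set Implicit Arguments.
Unset Strict Implicit.
Unset Printing Implicit Defensive.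

Import Order.TTheory GRing.Theory Num.Theory.

Local Open Scope ring_scope.

(** * Fraction fields and derivations *)

Notation "x %:F" := (@FracField.tofrac _ x) : ring_scope.

(** Additivity is kept as a plain hypothesis, since most of the additive maps
    below are built in the middle of a proof. *)
Section MorphD.
Variables (U V : zmodType) (f : U -> V).
Hypothesis fD : {morph f : x y / x + y}.

Lemma morphD0 : f 0 = 0.
Proof. by apply: (addrI (f 0)); rewrite -fD !addr0. Qed.

Lemma morphDN : {morph f : x / - x}.
Proof. by move=> x; apply: (addrI (f x)); rewrite -fD !subrr morphD0. Qed.

Lemma morphDB : {morph f : x y / x - y}.
Proof. by move=> x y; rewrite fD morphDN. Qed.

Lemma morphDMn n : {morph f : x / x *+ n}.
Proof.
by move=> x; elim: n => [|n IHn]; rewrite ?mulr0n ?morphD0// !mulrS fD IHn.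
Qed.

Lemma morphD_sum I (r : seq I) (P : pred I) (F : I -> U) :
  f (\sum_(i <- r | P i) F i) = \sum_(i <- r | P i) f (F i).
Proof. exact: (big_morph f fD morphD0). Qed.
End MorphD.


Section FractionField.
Variables (D : idomainType) (K : fieldType) (e : {rmorphism D -> K}).

(** All facts on fraction fields are proved for a field K that is only known
    through e. The same lemmas then serve F, F(x) and F(x, y), whatever the
    construction of these fields. *)
Definition fraction_field :=
  injective e /\ forall x, exists p q, q != 0 /\ x = e p / e q.

Hypothesis eK : fraction_field.

Lemma frac_eq0 p : (e p == 0) = (p == 0).
Proof. by rewrite -(inj_eq eK.1) rmorph0. Qed.

Lemma frac_ext (L : fieldType) (h : {rmorphism D -> L}) :
  injective h -> exists H : {rmorphism K -> L}, forall p, H (e p) = h p.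
Proof.
move=> hI.
have h0 p : p != 0 -> h p != 0 by move=> ?; rewrite -(rmorph0 h) (inj_eq hI).
have ex x : exists y, forall p q, q != 0 -> x = e p / e q -> y = h p / h q.
  have [p [q [q0 ->]]] := eK.2 x; exists (h p / h q) => p' q' q'0 /eqP.
  rewrite eqr_div ?frac_eq0// -!rmorphM (inj_eq eK.1) => /eqP epq.
  by apply/eqP; rewrite eqr_div ?h0// -!rmorphM epq.
pose H x := projT1 (cid (ex x)).
have HE p q : q != 0 -> H (e p / e q) = h p / h q.
  by move=> q0; rewrite /H; case: cid => y /= /(_ p q q0 erefl).
have HE1 p : H (e p) = h p.
  by have := HE p 1 (oner_neq0 _); rewrite !rmorph1 !divr1.
have HB : zmod_morphism H.
  move=> x y; have [p [q [q0 ->]]] := eK.2 x; have [r [s [s0 ->]]] := eK.2 y.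
  rewrite -mulNr addf_div ?frac_eq0// -rmorphN -!rmorphM -rmorphD.
  rewrite !HE ?mulf_neq0// -mulNr addf_div ?h0//.
  by rewrite -rmorphN -!rmorphM -rmorphD.
have HM : monoid_morphism H.
  split=> [|x y]; first by rewrite -(rmorph1 e) HE1 rmorph1.
  have [p [q [q0 ->]]] := eK.2 x; have [r [s [s0 ->]]] := eK.2 y.
  by rewrite mulf_div -!rmorphM !HE ?mulf_neq0// mulf_div -!rmorphM.
pose HA := GRing.isZmodMorphism.Build _ _ H HB.
pose HM' := GRing.isMonoidMorphism.Build _ _ H HM.
pose H' : {rmorphism K -> L} := HB.pack H HA HM'.
by exists H'.
Qed.

Lemma frac_pow_eq n (p q f g : D) (w : K) :
  q != 0 -> w = e p / e q -> w ^+ n * e g = e f -> p ^+ n * g = q ^+ n * f.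
Proof.
move=> q0 -> E; have Q0 : e q != 0 by rewrite frac_eq0.
apply: eK.1; rewrite !rmorphM -E expr_div_n !rmorphXn.
by rewrite mulrA mulrCA mulfV ?mulr1// expf_neq0.
Qed.

End FractionField.

Lemma tofrac_fraction_field (D : idomainType) :
  fraction_field (@FracField.tofrac D).
Proof.
split=> [p q /eqP|]; first by rewrite tofrac_eq => /eqP.
elim/quotW => r; exists (\n_r), (\d_r).
split; first exact: denom_ratioP.
have d0 : (\d_r)%:F != 0 :> {fraction D} by rewrite tofrac_eq0 denom_ratioP.
apply: (mulIf d0); rewrite divfK//; apply/eqP.
rewrite !piE FracField.equivfE /FracField.mulf.
by rewrite !numden_Ratio ?oner_eq0 ?mulr1 ?denom_ratioP// mulrC.
Qed.

Section Derivation.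

(** Derivations along i. For i = id these are the derivations of a field;
    their restrictions to a subring are derivations along the inclusion. *)
Definition derivation (D E : nzRingType) (i : D -> E) (d : D -> E) :=
  {morph d : x y / x + y} /\ forall x y, d (x * y) = d x * i y + i x * d y.

Lemma derivation1 (D E : nzRingType) (i : {rmorphism D -> E}) d :
  derivation i d -> d 1 = 0.
Proof.
case=> _ dM; apply: (addrI (d 1)); rewrite addr0.
by have := dM 1 1; rewrite !mulr1 rmorph1 mulr1 mul1r.
Qed.

Lemma derivation_div (D E : fieldType) (i : {rmorphism D -> E}) d x y :
  derivation i d -> y != 0 -> d (x / y) = (d x * i y - i x * d y) / i y ^+ 2.
Proof.
move=> [dD dM] y0; have iy0 : i y != 0 by rewrite fmorph_eq0.
have := dM (x / y) y; rewrite divfK// rmorphM fmorphV => ->.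
by field.
Qed.

Section QuotientRule.
Variable F : fieldType.
Implicit Types p q r s : F.

Lemma quotient_rule_eq (p q p' q' dp dq dp' dq' : F) : q != 0 -> q' != 0 ->
  p * q' = p' * q -> dp * q' + p * dq' = dp' * q + p' * dq ->
  (dp * q - p * dq) / q ^+ 2 = (dp' * q' - p' * dq') / q' ^+ 2.
Proof.
move=> q0 q'0 e e1; have eP : p = p' * q / q' by rewrite -e mulfK.
have -> : dp = (dp' * q + p' * dq - p * dq') / q' by rewrite -e1 addrK mulfK.
by rewrite eP; field; rewrite q0 q'0.
Qed.

Lemma quotient_ruleD (p q r s dp dq dr ds : F) : q != 0 -> s != 0 ->
  ((dp * s + p * ds + (dr * q + r * dq)) * (q * s)
     - (p * s + r * q) * (dq * s + q * ds)) / (q * s) ^+ 2 =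
  (dp * q - p * dq) / q ^+ 2 + (dr * s - r * ds) / s ^+ 2.
Proof. by move=> q0 s0; field; rewrite q0 s0. Qed.

Lemma quotient_ruleM (p q r s dp dq dr ds : F) : q != 0 -> s != 0 ->
  ((dp * r + p * dr) * (q * s) - p * r * (dq * s + q * ds)) / (q * s) ^+ 2 =
  (dp * q - p * dq) / q ^+ 2 * (r / s) + p / q * ((dr * s - r * ds) / s ^+ 2).
Proof. by move=> q0 s0; field; rewrite q0 s0. Qed.
End QuotientRule.

Section FractionDerivation.
Variables (D : idomainType) (K : fieldType) (e : {rmorphism D -> K}).
Hypothesis eK : fraction_field e.

(** The quotient rule defines the extension; by quotient_rule_eq its value
    does not depend on the fraction that represents the argument. *)
Lemma frac_derivation (d : D -> K) : derivation e d ->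
  exists2 d' : K -> K, derivation id d' & forall p, d' (e p) = d p.
Proof.
move=> dd; have [dD dM] := dd.
have d1 : d 1 = 0 := derivation1 dd.
have ex x : exists y, forall p q, q != 0 -> x = e p / e q ->
    y = (d p * e q - e p * d q) / e q ^+ 2.
  have [p [q [q0 ->]]] := eK.2 x.
  exists ((d p * e q - e p * d q) / e q ^+ 2) => p' q' q'0 /eqP.
  rewrite eqr_div ?(frac_eq0 eK)// -!rmorphM (inj_eq eK.1) => /eqP epq.
  have e1 := congr1 d epq; have e2 := congr1 e epq.
  rewrite !dM in e1; rewrite !rmorphM in e2.
  by apply: quotient_rule_eq; rewrite ?(frac_eq0 eK).
pose d' x := projT1 (cid (ex x)).
have dE p q : q != 0 -> d' (e p / e q) = (d p * e q - e p * d q) / e q ^+ 2.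
  by move=> q0; rewrite /d'; case: cid => y /= /(_ p q q0 erefl).
have dE1 p : d' (e p) = d p.
  have := dE p 1 (oner_neq0 _).
  by rewrite rmorph1 !divr1 expr1n divr1 d1 mulr0 subr0 mulr1.
exists d' => //; split=> x y.
  have [p [q [q0 ->]]] := eK.2 x; have [r [s [s0 ->]]] := eK.2 y.
  rewrite addf_div ?(frac_eq0 eK)// -!rmorphM -rmorphD !dE ?mulf_neq0//.
  by rewrite dD !dM !rmorphD !rmorphM quotient_ruleD ?(frac_eq0 eK).
have [p [q [q0 ->]]] := eK.2 x; have [r [s [s0 ->]]] := eK.2 y.
rewrite mulf_div -!rmorphM !dE ?mulf_neq0//.
by rewrite !dM !rmorphM quotient_ruleM ?(frac_eq0 eK).
Qed.

Lemma derivation_frac_eq0 (L : fieldType) (j : {rmorphism K -> L})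
    (d : K -> L) :
  derivation j d -> (forall p, d (e p) = 0) -> forall x, d x = 0.
Proof.
move=> dd d0 x; have [p [q [q0 ->]]] := eK.2 x.
rewrite (derivation_div _ dd) ?(frac_eq0 eK)//.
by rewrite !d0 mulr0 mul0r subrr mul0r.
Qed.
End FractionDerivation.

Lemma derivation_rat (F L : fieldType) (j : {rmorphism F -> L}) (d : F -> L)
    (i : {rmorphism rat -> F}) c : derivation j d -> d (i c) = 0.
Proof.
move=> dd; have dn (n : nat) : d n%:R = 0.
  by rewrite (morphDMn dd.1) (derivation1 dd) mul0rn.
have dz (z : int) : d z%:~R = 0.
  case: z => n; rewrite ?dn// NegzE mulrNz (morphDN dd.1).
  by rewrite -pmulrn dn oppr0.
rewrite -[c]divq_num_den fmorph_div !rmorph_int (derivation_div _ dd).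
  by rewrite !dz mulr0 mul0r subrr mul0r.
by rewrite -(rmorph_int i) fmorph_eq0 intr_eq0 denq_neq0.
Qed.

End Derivation.

(** * Monomials and constants in the group algebra *)

Section GroupAlgebra.
Variable G : zmodType.
Local Notation QG := (grpalg rat G).
Implicit Types (f g : QG) (a b : G) (c : rat).

Definition gaMono c a : QG := << c *g a >>.

Lemma gaMono_eq c a c' b :
  c != 0 -> gaMono c a = gaMono c' b -> c = c' /\ a = b.
Proof.
move=> c0 /malgP e; have := e a; rewrite mcoeffUU mcoeffU.
by case: eqP => [->|_] // ec; rewrite ec eqxx in c0.
Qed.

Lemma gaMonoM c a c' b : gaMono c a * gaMono c' b = gaMono (c * c') (a + b).
Proof. exact: ga_mulUU. Qed.

Lemma gaMono_neq0 c a : c != 0 -> gaMono c a != 0.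
Proof. by move=> c0; rewrite monalgU_eq0. Qed.

Lemma ga_ind (P : QG -> Prop) : (forall c a, P (gaMono c a)) ->
  (forall f g, P f -> P g -> P (f + g)) -> forall f, P f.
Proof.
move=> PM PD f; rewrite [f]monalgE.
apply: big_ind => // [|k _]; last exact: PM.
by have := PM 0 0; rewrite /gaMono monalgU0.
Qed.

Definition gaC c : QG := gaMono c 0.

Fact gaC_zmod : zmod_morphism gaC.
Proof. by move=> x y; rewrite /gaC /gaMono monalgUB. Qed.
Fact gaC_monoid : monoid_morphism gaC.
Proof. by split=> // x y; rewrite /gaC gaMonoM addr0. Qed.
HB.instance Definition _ := GRing.isZmodMorphism.Build rat QG gaC gaC_zmod.
HB.instance Definition _ := GRing.isMonoidMorphism.Build rat QG gaC gaC_monoid.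

Lemma gaMonoE c a : gaMono c a = gaC c * gaX rat a.
Proof. by rewrite gaMonoM mulr1 add0r. Qed.

Section Lift.
Variables (E : comNzRingType) (i : {rmorphism rat -> E}) (h : G -> E).

Lemma mmap_gaMono c a : mmap i h (gaMono c a) = i c * h a.
Proof. exact: mmapU. Qed.

Lemma mmap_gaD f g : mmap i h (f + g) = mmap i h f + mmap i h g.
Proof. exact: mmapD. Qed.

Lemma ga_lift : h 0 = 1 -> {morph h : a b / a + b >-> a * b} ->
  exists H : {rmorphism QG -> E}, forall f, H f = mmap i h f.
Proof.
move=> h1 hD; pose H : QG -> E := mmap i h.
have HB : zmod_morphism H by move=> f g; exact: mmapB.
have HM : monoid_morphism H.
  split; first by rewrite /H -[1]/(gaMono 1 0) mmap_gaMono rmorph1 h1 mulr1.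
  elim/ga_ind => [c a|f1 f2 IH1 IH2] g; last first.
    by rewrite /H mulrDl !mmap_gaD -!/(H _) IH1 IH2 mulrDl.
  elim/ga_ind: g => [c' b|f1 f2 IH1 IH2]; last first.
    by rewrite /H mulrDr !mmap_gaD -!/(H _) IH1 IH2 mulrDr.
  by rewrite /H gaMonoM !mmap_gaMono rmorphM hD mulrACA.
pose HA := GRing.isZmodMorphism.Build _ _ H HB.
pose HM' := GRing.isMonoidMorphism.Build _ _ H HM.
pose H' : {rmorphism QG -> E} := HB.pack H HA HM'.
by exists H'.
Qed.
End Lift.

Definition nterms f : nat := #|` msupp f|.

Lemma nterms_gaMono c a : (nterms (gaMono c a) <= 1)%N.
Proof. by rewrite -(cardfs1 a) /nterms fsubset_leq_card// msuppU_le. Qed.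

Lemma msupp_mul_sub f g :
  {subset msupp (f * g) <= [seq a + b | a <- msupp f, b <- msupp g]}.
Proof.
move=> k; rewrite -mcoeff_neq0 => k0; apply: contraNT k0 => knot; apply/eqP.
rewrite [_ * _]/(ga_mul f g) mcoeff_ga_mul.
rewrite big_seq big1// => a af; rewrite big_seq big1// => b bg.
case: eqP => // e; case/negP: knot; apply/allpairsP; exists (a, b).
by split.
Qed.

Lemma ntermsM f g : (nterms (f * g)%R <= nterms f * nterms g)%N.
Proof.
rewrite /nterms -[X in (_ <= X)%N](size_allpairs +%R).
by apply: uniq_leq_size; [exact: fset_uniq|exact: msupp_mul_sub].
Qed.

Lemma nterms_gt0 f : f != 0 -> (0 < nterms f)%N.
Proof.
move=> f0; rewrite cardfs_gt0; apply: contra_neq f0 => s0.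
by apply/malgP => k; rewrite mcoeff0 mcoeff_outdom// s0.
Qed.

End GroupAlgebra.

Section FractionsOfGroupAlgebra.
Variables (G : tfZmodType) (K : fieldType) (e : {rmorphism grpalg rat G -> K}).
Hypothesis eK : fraction_field e.
Implicit Types (a b : G) (c : rat).

Definition cstF c : K := e (gaC G c).
HB.instance Definition _ := GRing.RMorphism.copy cstF (e \o gaC G).

Definition monF a : K := e (gaX rat a).

Lemma cstF_neq0 c : c != 0 -> cstF c != 0.
Proof. by rewrite fmorph_eq0. Qed.

Lemma cstFM c d : cstF (c * d) = cstF c * cstF d.
Proof. exact: rmorphM. Qed.

Lemma cstF_div c d : cstF (c / d) = cstF c / cstF d.
Proof. exact: fmorph_div. Qed.

Lemma monF_neq0 a : monF a != 0.
Proof. by rewrite (frac_eq0 eK) gaMono_neq0. Qed.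

Lemma monF0 : monF 0 = 1.
Proof. by rewrite /monF gaX0 rmorph1. Qed.

Lemma monFD a b : monF (a + b) = monF a * monF b.
Proof. by rewrite /monF gaXD rmorphM. Qed.

Lemma monFN a : monF (- a) = (monF a)^-1.
Proof.
by apply: (mulIf (monF_neq0 a)); rewrite -monFD addNr monF0 mulVf ?monF_neq0.
Qed.

Lemma frac_gaMono c a : e (gaMono c a) = cstF c * monF a.
Proof. by rewrite gaMonoE rmorphM. Qed.

Lemma cst_monF_inj c a c' b :
  c != 0 -> cstF c * monF a = cstF c' * monF b -> c = c' /\ a = b.
Proof. by move=> c0; rewrite -!frac_gaMono => /eK.1; exact: gaMono_eq. Qed.

Lemma cst_monF_mul_eq c a c' b d g : c != 0 -> c' != 0 ->
  cstF d * monF g = (cstF c * monF a) * (cstF c' * monF b) -> g = a + b.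
Proof.
move=> c0 c'0; rewrite mulrACA -monFD -cstFM => /esym.
by move/(cst_monF_inj (mulf_neq0 c0 c'0)) => [].
Qed.

Lemma cst_monF_div c a c' b :
  cstF c * monF a / (cstF c' * monF b) = cstF (c / c') * monF (a - b).
Proof. by rewrite monFD monFN cstF_div invfM mulrACA. Qed.

(** The Leibniz rule holds on monomials because del is additive. Conversely
    the logarithmic derivative a |-> d (X^a) / X^a of a derivation d of K is
    additive and determines d (derivation_monF_eq0): the derivations of K are
    the additive maps from G to K. *)
Lemma derivation_of_additive (del : G -> K) : {morph del : a b / a + b} ->
  exists2 d : K -> K, derivation id d & forall a, d (monF a) = del a * monF a.
Proof.
move=> delD; pose h a := del a * monF a.
pose d f := mmap cstF h f.
have dd : derivation e d.
  split=> [f g|]; first exact: mmapD.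
  elim/ga_ind => [c a|f1 f2 IH1 IH2] g; last first.
    rewrite /d mulrDl !mmap_gaD -!/(d _) IH1 IH2 rmorphD; ring.
  elim/ga_ind: g => [c' b|f1 f2 IH1 IH2]; last first.
    rewrite /d mulrDr !mmap_gaD -!/(d _) IH1 IH2 rmorphD; ring.
  rewrite /d gaMonoM !mmap_gaMono !frac_gaMono rmorphM /h delD monFD; ring.
have [D DD DE] := frac_derivation eK dd; exists D => // a.
by rewrite DE /d mmap_gaMono rmorph1 mul1r.
Qed.

Lemma derivation_cstF (L : fieldType) (j : {rmorphism K -> L}) (d : K -> L) c :
  derivation j d -> d (cstF c) = 0.
Proof. exact: (@derivation_rat _ _ j d cstF). Qed.

Lemma derivation_monF_eq0 (L : fieldType) (j : {rmorphism K -> L})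
    (d : K -> L) :
  derivation j d -> (forall a, d (monF a) = 0) -> forall x, d x = 0.
Proof.
move=> dd d0; suff de p : d (e p) = 0.
  exact: (@derivation_frac_eq0 _ _ e eK _ j d dd de).
elim/ga_ind: p => [c a|f g IH1 IH2]; last by rewrite rmorphD dd.1 IH1 IH2 addr0.
by rewrite frac_gaMono dd.2 d0 (derivation_cstF _ dd) mul0r mulr0 addr0.
Qed.

End FractionsOfGroupAlgebra.

(** * Multiplicities of roots of sparse polynomials *)

Section SparsePoly.
Variable L : fieldType.
Hypothesis charL : [pchar L] =i pred0.
Implicit Types (p q f g : {poly L}) (s : seq nat).

Let natI (m n : nat) : (m%:R == n%:R :> L) = (m == n).
Proof.
wlog le_mn : m n / (m <= n)%N => [W|].
  by case/orP: (leq_total m n) => /W// e; rewrite eq_sym e eq_sym.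
rewrite -{1}(subnK le_mn) natrD -[X in X == _]add0r (inj_eq (addIr _)).
rewrite eq_sym (pcharf0P _).1; first by rewrite subn_eq0 eqn_leq le_mn.
by move=> p; exact: charL.
Qed.

(** In characteristic 0 the multiplicity of a nonzero root of f is less than
    the number of terms of f; a general p in place of X - c covers the roots
    that are not in L. The operator f |-> k f - X f' multiplies the
    coefficient of X^i by k - i. For k in the support of f it removes exactly
    one term, and it lowers the exponent of p that divides f by one at most.
    It does not kill f, since otherwise p would divide a multiple of X^k, to
    which it is coprime. *)
Lemma root_mult_sparse n p f s : ~~ root p 0 -> (1 < size p)%N -> f != 0 ->
  p ^+ n %| f -> (forall i, f`_i != 0 -> i \in s) -> (n < size s)%N.
Proof.
move=> p00 p_gt1; elim: n f s => [|n IHn] f s f0 pf fs.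
  have /fs : f`_(size f).-1 != 0 by rewrite -lead_coefE lead_coef_eq0.
  by case: s {fs}.
set k := (size f).-1.
have fk0 : f`_k != 0 by rewrite -lead_coefE lead_coef_eq0.
have ks : k \in s by apply: fs.
pose h := k%:R *: f - 'X * f^`().
have hE i : h`_i = (k%:R - i%:R) * f`_i.
  rewrite coefB coefZ coefXM; case: i => [|i] /=; first by rewrite !subr0.
  by rewrite coef_deriv mulrBl -[f`_i.+1 *+ _]mulr_natl.
have pf' : p ^+ n %| f by apply: dvdp_trans pf; rewrite exprS dvdp_mulIr.
have ph : p ^+ n %| h.
  rewrite /h -mul_polyC dvdp_sub ?dvdp_mull//.
  have /dvdpP[q fE] := pf.
  rewrite fE.
  rewrite derivM deriv_exp dvdp_add//.
    by rewrite dvdp_mull// exprS dvdp_mull.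
  by rewrite dvdp_mull// -mulrnAl dvdp_mull.
have [h0|h0] := eqVneq h 0.
  have fk : f = f`_k *: 'X^k.
    apply/polyP => i; rewrite coefZ coefXn; case: eqVneq => [->|ik].
      by rewrite mulr1.
    have := hE i; rewrite h0 coef0 mulr0 => /esym/eqP; rewrite mulf_eq0.
    by rewrite subr_eq0 natI eq_sym (negPf ik) /= => /eqP.
  have pX : p %| 'X^k.
    rewrite -(dvdpZr (c := f`_k))// -fk.
    by apply: dvdp_trans pf; rewrite exprS dvdp_mulIl.
  have : coprimep p 'X^k by rewrite coprimep_expr// coprimepX.
  by move=> /coprimepP/(_ p (dvdpp _) pX); rewrite -size_poly_eq1 gtn_eqF.
have := IHn h (rem k s) h0 ph; rewrite size_rem// => lt_n.
have -> : size s = (size s).-1.+1 by case: (s) ks.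
rewrite ltnS; apply: lt_n => i; rewrite hE mulf_eq0 negb_or => /andP[ki /fs si].
move: si; rewrite (perm_mem (perm_to_rem ks)) inE => /orP[/eqP ik|//].
by rewrite ik subrr eqxx in ki.
Qed.

(** When the factor X^i is removed from p, what is left has no root at 0, and
    root_mult_sparse forces it to be constant. *)
Lemma dvd_exp_sparse n p f s : f != 0 -> p ^+ n %| f -> p != 0 ->
  (forall i, f`_i != 0 -> i \in s) -> (size s <= n)%N ->
  exists2 c, c != 0 & exists i, p = c *: 'X^i.
Proof.
move=> f0 pf p0 fs sn; have [i [q]] := multiplicity_XsubC p 0.
rewrite p0 subr0 /= => q00 pE; exists q`_0.
  by rewrite -horner_coef0 -rootE.
exists i; rewrite pE.
have qf : q ^+ n %| f.
  by apply: dvdp_trans pf; rewrite pE exprMn dvdp_mulIl.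
have := @root_mult_sparse n q f s q00 _ f0 qf fs.
case: ltnP => [_ /(_ isT)|/size1_polyC -> _]; first by rewrite ltnNge sn.
by rewrite coefC /= mul_polyC.
Qed.

(** After division by the gcd of p and q, the n-th power of p divides f and
    that of q divides g, so that dvd_exp_sparse makes monomials of both. *)
Lemma sparse_power_ratio n p q f g s t : p != 0 -> q != 0 -> f != 0 -> g != 0 ->
  p ^+ n * g = q ^+ n * f ->
  (forall i, f`_i != 0 -> i \in s) -> (size s <= n)%N ->
  (forall i, g`_i != 0 -> i \in t) -> (size t <= n)%N -> (0 < n)%N ->
  exists2 c, c != 0 & exists i j, 'X^i * p = c *: ('X^j * q).
Proof.
move=> p0 q0 f0 g0 e fs sn gt tn n0; pose d := gcdp p q.
have d0 : d != 0 by rewrite gcdp_eq0 negb_and p0.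
have := dvdp_gcdl p q; have := dvdp_gcdr p q.
rewrite -/d => /dvdpP[q1 qE] /dvdpP[p1 pE].
have p10 : p1 != 0 by apply: contra_neq p0; rewrite pE => ->; rewrite mul0r.
have q10 : q1 != 0 by apply: contra_neq q0; rewrite qE => ->; rewrite mul0r.
have cop : coprimep p1 q1.
  have := coprimep_div_gcd (p := p) (q := q); rewrite p0 /= => /(_ isT).
  by rewrite -/d {1}pE qE !mulpK.
have e1 : p1 ^+ n * g = q1 ^+ n * f.
  apply: (mulfI (expf_neq0 n d0)); move: e.
  by rewrite pE qE !exprMn ![_ * d ^+ n]mulrC -!mulrA.
have pf : p1 ^+ n %| f.
  rewrite -(@Gauss_dvdpr _ _ (q1 ^+ n)) ?coprimep_pexpl ?coprimep_pexpr//.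
  by rewrite -e1 dvdp_mulIl.
have qg : q1 ^+ n %| g.
  rewrite -(@Gauss_dvdpr _ _ (p1 ^+ n)); last first.
    by rewrite ?coprimep_pexpl ?coprimep_pexpr// coprimep_sym.
  by rewrite e1 dvdp_mulIl.
have [c c0 [j p1E]] := dvd_exp_sparse f0 pf p10 fs sn.
have [c' c'0 [i q1E]] := dvd_exp_sparse g0 qg q10 gt tn.
exists (c / c'); first by rewrite mulf_neq0// invr_eq0.
exists i, j; rewrite pE qE p1E q1E -!scalerAl -!scalerAr scalerA.
by rewrite divfK// mulrCA.
Qed.

End SparsePoly.

(** * Powers with few terms *)

Lemma sqr_int_eq2 (a b : int) : a ^+ 2 = 2 * b ^+ 2 -> b = 0.
Proof.
move=> e; apply/eqP; apply: contraT => b0.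
have {}e : (absz a ^ 2 = 2 * absz b ^ 2)%N by nia.
have b0' : (0 < absz b)%N by rewrite absz_gt0.
have a0' : (0 < absz a)%N.
  by have := expn_gt0 (absz a) 2; rewrite orbF e muln_gt0 expn_gt0 b0'.
have := congr1 (logn 2) e; rewrite lognM ?expn_gt0 ?b0'// !lognX.
by rewrite [logn 2 2]logn_prime//=; lia.
Qed.

Lemma sqr_rat_neq2 (c : rat) : c ^+ 2 != 2.
Proof.
apply/eqP => c2; have d0 : denq c != 0 by rewrite denq_neq0.
have := d0; rewrite (@sqr_int_eq2 (numq c) (denq c)) ?eqxx//.
have cE : (numq c)%:~R = c * (denq c)%:~R by rewrite numqE.
apply: (@intr_inj rat); rewrite !expr2 !intrM cE mulrACA -expr2 c2.
by rewrite -expr2.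
Qed.

(** What is used of the embedding of A in a power of Z. Questions on finitely
    many monomials X^a are reduced to one variable by a single functional that
    is nonzero on all the differences at stake (separated_seq). *)
Definition separated (G : zmodType) := forall a : G, a != 0 ->
  exists2 l : G -> int, {morph l : x y / x + y} & l a != 0.

(** If l kills the new element d and l' does not, then l' + M l suits d and
    all the former elements, once M exceeds the values of l' at the latter. *)
Lemma separated_seq (G : zmodType) (s : seq G) : separated G ->
  exists2 l : G -> int, {morph l : x y / x + y} &
    forall a, a \in s -> a != 0 -> l a != 0.
Proof.
move=> sepG; elim: s => [|d s [l lD ls]].
  by exists (fun=> 0) => // x y; rewrite addr0.
have [d0|d0] := eqVneq d 0.
  by exists l => // a; rewrite inE => /orP[/eqP->|/ls//]; rewrite d0 eqxx.
have [ld0|ld] := eqVneq (l d) 0; last first.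
  by exists l => // a; rewrite inE => /orP[/eqP->|/ls].
have [l' l'D l'd] := sepG d d0.
pose M : int := 1 + \sum_(a <- s) `|l' a|.
have M_gt a : a \in s -> `|l' a| < M.
  move=> sa; rewrite /M ltz1D big_tnth.
  have /tnthP[i ->] : a \in in_tuple s by [].
  rewrite (bigD1 i)//= lerDl sumr_ge0// => j _; exact: normr_ge0.
exists (fun a => l' a + M * l a) => [x y|a].
  by rewrite l'D lD mulrDr addrACA.
rewrite inE => /orP[/eqP-> _|sa a0]; first by rewrite ld0 mulr0 addr0.
have la := ls a sa a0; apply/eqP => e.
have e1 : l' a = - (M * l a) by apply/eqP; rewrite -addr_eq0 e.
have := M_gt a sa; rewrite e1 normrN normrM; apply/negP; rewrite -leNgt.
have M0 : 0 <= M by rewrite (le_trans _ (ltW (M_gt a sa))).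
rewrite ger0_norm// ler_peMr//.
by rewrite -gtz0_ge1 normr_gt0.
Qed.

(** The polynomials p', q', f', g' represent images under h only up to the
    common factor x. Both sides of the identity have degree n + 1, so that the
    powers of x agree. *)
Lemma scaled_lift_exp (D : comNzRingType) (E : idomainType) (F : fieldType)
    (i : {rmorphism E -> F}) (h : {rmorphism D -> F}) (x : F) n
    (p q f g : D) (p' q' f' g' : E) : injective i ->
  i p' = x * h p -> i q' = x * h q -> i f' = x * h f -> i g' = x * h g ->
  p ^+ n * g = q ^+ n * f -> p' ^+ n * g' = q' ^+ n * f'.
Proof.
move=> iI pE qE fE gE e; apply: iI; rewrite !rmorphM !rmorphXn.
rewrite pE qE fE gE !exprMn mulrACA [RHS]mulrACA.
by rewrite -!rmorphXn -!rmorphM e.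
Qed.

Section SparsePower.
Variables (G : tfZmodType) (K : fieldType) (e : {rmorphism grpalg rat G -> K}).
Hypotheses (sepG : separated G) (eK : fraction_field e).
Local Notation QG := (grpalg rat G).
Implicit Types (f g : QG) (a b : G) (c : rat).

Lemma pchar_frac : [pchar K] =i pred0.
Proof. by move=> p; rewrite (fmorph_pchar (cstF e)) pchar_num. Qed.

Section Coaction.
Variables (l : G -> int) (m : nat) (U : seq G).
Hypothesis lD : {morph l : x y / x + y}.
Hypothesis lI : {in U &, injective l}.
Hypothesis lm : forall a, a \in U -> 0 <= l a + m%:Z.

Definition coact_exp a : nat := absz (l a + m%:Z).

(** The image of f under X^a |-> X^a T^(l a), multiplied by T^m to make it a
    polynomial in T. If l is injective on the support of f, distinct terms of
    f go to distinct powers of T, while T = 1 gives f back. *)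
Definition coact f : {poly K} :=
  \sum_(a <- msupp f) (cstF e f@_a * monF e a) *: 'X^(coact_exp a).

Lemma coact_exp_inj : {in U &, injective coact_exp}.
Proof.
move=> a b Ua Ub /(congr1 Posz); rewrite /coact_exp !gez0_abs ?lm//.
by move/addIr; apply: lI.
Qed.

Lemma horner_coact f : (coact f).[1] = e f.
Proof.
rewrite [in RHS](monalgE f) horner_sum rmorph_sum; apply: eq_bigr => a _.
by rewrite hornerZ hornerXn expr1n mulr1 -frac_gaMono.
Qed.

Lemma coact_supp f i :
  (coact f)`_i != 0 -> i \in [seq coact_exp a | a <- msupp f].
Proof.
apply: contraR => ni; rewrite coef_sum big_seq big1// => a af.
rewrite coefZ coefXn; case: eqVneq => [ia|]; last by rewrite mulr0.
by case/negP: ni; apply/mapP; exists a.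
Qed.

Lemma coact_coef f a : {subset msupp f <= U} -> a \in msupp f ->
  (coact f)`_(coact_exp a) = cstF e f@_a * monF e a.
Proof.
move=> fU af; rewrite coef_sum (big_fsetD1 a)//= coefZ coefXn eqxx mulr1.
rewrite big_seq big1 ?addr0// => b; rewrite in_fsetD1 => /andP[ba bf].
rewrite coefZ coefXn; case: eqVneq => [ab|]; last by rewrite mulr0.
by rewrite (coact_exp_inj (fU _ af) (fU _ bf) ab) eqxx in ba.
Qed.

Lemma coact_neq0 f : {subset msupp f <= U} -> f != 0 -> coact f != 0.
Proof.
move=> fU /nterms_gt0; rewrite cardfs_gt0 => /fset0Pn[a af].
have fa : f@_a != 0 by rewrite mcoeff_neq0.
apply: contraTneq isT => f0; have /esym/eqP := coact_coef fU af.
by rewrite f0 coef0 mulf_eq0 fmorph_eq0 (negPf fa) (negPf (monF_neq0 eK _)).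
Qed.

(** As l is additive, X^a |-> X^a T^(l a) extends to a ring morphism into
    K(T). *)
Lemma coactM_exp n (p q f g : QG) :
  {subset msupp p <= U} -> {subset msupp q <= U} ->
  {subset msupp f <= U} -> {subset msupp g <= U} ->
  p ^+ n * g = q ^+ n * f ->
  coact p ^+ n * coact g = coact q ^+ n * coact f.
Proof.
pose i : {rmorphism rat -> {fraction {poly K}}} :=
  (@FracField.tofrac {poly K} \o (polyC \o cstF e)).
pose X : {fraction {poly K}} := 'X%:F.
have X0 : X != 0 by rewrite tofrac_eq0 polyX_eq0.
pose h a : {fraction {poly K}} := (monF e a)%:P%:F * X ^ (l a).
have [||phi phiE] := @ga_lift _ _ i h.
- by rewrite /h monF0 (morphD0 lD) expr0z mulr1 polyC1 tofrac1.
- by move=> a b; rewrite /h monFD lD polyCM tofracM expfzDr// mulrACA.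
have coactE r : {subset msupp r <= U} -> (coact r)%:F = X ^+ m * phi r.
  move=> rU; rewrite phiE rmorph_sum mulr_sumr big_seq [RHS]big_seq.
  apply: eq_bigr => a ar; rewrite /= -mul_polyC tofracM polyCM tofracM.
  rewrite -mulrA [RHS]mulrCA; congr (_ * _).
  rewrite /h [RHS]mulrCA; congr (_ * _).
  rewrite tofracXn -/X -[X ^+ m]/(X ^ m) -expfzDr// addrC.
  by rewrite -(gez0_abs (lm (rU _ ar))).
move=> pU qU fU gU.
apply: (@scaled_lift_exp _ _ _ _ phi (X ^+ m)); try exact: coactE.
exact: (tofrac_fraction_field _).1.
Qed.
End Coaction.

(** Write w = p / q and choose l injective on all the exponents at stake. By
    sparse_power_ratio the polynomials in T attached to p and q are
    proportional up to powers of T. The factor is w, as T = 1 shows, and a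
    comparison of one coefficient, which is a single term on each side, shows
    that it is a monomial. *)
Lemma sparse_power n (w : K) (f g : QG) : (0 < n)%N -> f != 0 -> g != 0 ->
  (nterms f <= n)%N -> (nterms g <= n)%N -> w ^+ n * e g = e f ->
  exists2 c, c != 0 & exists a, w = cstF e c * monF e a.
Proof.
move=> n0 f0 g0 fn gn wfg; have [p [q [q0 wE]]] := eK.2 w.
have eQ : p ^+ n * g = q ^+ n * f by exact: (@frac_pow_eq _ _ e eK n p q f g w).
have p0 : p != 0.
  apply: contra_neq (mulf_neq0 (expf_neq0 n q0) f0) => p0.
  by rewrite -eQ p0 expr0n eqn0Ngt n0 mul0r.
pose U : seq G := msupp p ++ msupp q ++ msupp f ++ msupp g.
have [l lD lU] := separated_seq [seq x - y | x <- U, y <- U] sepG.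
have lI : {in U &, injective l}.
  move=> a b Ua Ub lab; apply/eqP; rewrite -subr_eq0; apply: contraT => /lU.
  rewrite (morphDB lD) lab subrr eqxx; apply.
  by apply/allpairsP; exists (a, b).
pose m := (\sum_(a <- U) `|l a|)%N.
have lm a : a \in U -> 0 <= l a + m%:Z.
  move=> Ua; have : (`|l a| <= m)%N.
    rewrite /m big_tnth; have /tnthP[i ->] : a \in in_tuple U by [].
    by rewrite (bigD1 i)//= leq_addr.
  lia.
have pU : {subset msupp p <= U} by move=> a ap; rewrite mem_cat ap.
have qU : {subset msupp q <= U} by move=> a ap; rewrite !mem_cat ap orbT.
have fU : {subset msupp f <= U} by move=> a ap; rewrite !mem_cat ap !orbT.
have gU : {subset msupp g <= U} by move=> a ap; rewrite !mem_cat ap !orbT.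
have nz (r : QG) : {subset msupp r <= U} -> r != 0 -> coact l m r != 0.
  exact: coact_neq0.
have supp_le (r : QG) : (nterms r <= n)%N ->
    (size [seq coact_exp l m a | a <- msupp r] <= n)%N.
  by rewrite size_map.
have [c c0 [i [j eX]]] := sparse_power_ratio pchar_frac
  (nz p pU p0) (nz q qU q0) (nz f fU f0) (nz g gU g0)
  (coactM_exp lD lm pU qU fU gU eQ)
  (@coact_supp l m f) (supp_le f fn) (@coact_supp l m g) (supp_le g gn) n0.
have wc : w = c.
  have := congr1 (fun r => r.[1]) eX.
  rewrite hornerZ !hornerM !hornerXn !expr1n !mul1r !horner_coact wE => ->.
  by rewrite mulfK// (frac_eq0 eK).
have := nterms_gt0 q0; rewrite cardfs_gt0 => /fset0Pn[b bq].
have qb : q@_b != 0 by rewrite mcoeff_neq0.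
(* At this power of T the right-hand side has the single term of q with
   exponent b. *)
have := congr1 (fun r : {poly K} => r`_(j + coact_exp l m b)) eX.
rewrite coefZ !coefXnM [in RHS]ltnNge leq_addr /= addKn.
rewrite (coact_coef lI lm qU bq).
case: ifP => [_ /esym/eqP|_ e1].
  rewrite !mulf_eq0 (negPf c0) (negPf (monF_neq0 eK _)).
  by rewrite -[cstF e _ == 0]negbK cstF_neq0.
have rhs0 : c * (cstF e q@_b * monF e b) != 0.
  by rewrite !mulf_neq0 ?(monF_neq0 eK) ?cstF_neq0.
have := rhs0; rewrite -e1 => /coact_supp/mapP[a ap ea].
move: e1; rewrite ea (coact_coef lI lm pU ap) => e1.
have pa : p@_a != 0 by rewrite mcoeff_neq0.
exists (p@_a / q@_b); first by rewrite mulf_neq0// invr_eq0.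
exists (a - b); rewrite wc monFD (monFN eK) cstF_div mulrACA -invfM.
by rewrite e1 mulfK// mulf_neq0 ?(monF_neq0 eK) ?cstF_neq0.
Qed.

(** A measure of size on the multiplicative group of K. Modulo the monomials
    c X^a it behaves as a discrete norm on an abelian group: the size of a
    quotient is bounded (sparse_ratio_div), and an element whose n-th power
    has size n is trivial (sparse_ratio_power). *)
Definition sparse_ratio (u : K) n := exists p q : QG,
  [/\ p != 0, q != 0, (nterms p <= n)%N, (nterms q <= n)%N & u * e q = e p].

Lemma sparse_ratio_exists u : u != 0 -> exists n, sparse_ratio u n.
Proof.
move=> u0; have [p [q [q0 uE]]] := eK.2 u.
have ue : u * e q = e p by rewrite uE divfK// (frac_eq0 eK).
exists (maxn (nterms p) (nterms q)), p, q; split=> //.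
- have : e p != 0 by rewrite -ue mulf_neq0// (frac_eq0 eK).
  by rewrite (frac_eq0 eK).
- exact: leq_maxl.
- exact: leq_maxr.
Qed.

Lemma sparse_ratio_le u n n' :
  (n <= n')%N -> sparse_ratio u n -> sparse_ratio u n'.
Proof.
move=> nn' [p [q [p0 q0 pn qn ue]]].
by exists p, q; split=> //; exact: leq_trans nn'.
Qed.

Lemma sparse_ratio_div u v n n' : v != 0 -> sparse_ratio u n ->
  sparse_ratio v n' -> sparse_ratio (u / v) (n * n')%N.
Proof.
move=> v0 [p [q [p0 q0 pn qn ue]]] [p' [q' [p'0 q'0 pn' qn' ve]]].
exists (p * q'), (q * p'); split; rewrite ?mulf_neq0//.
- exact: leq_trans (ntermsM _ _) (leq_mul pn qn').
- exact: leq_trans (ntermsM _ _) (leq_mul qn pn').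
by rewrite !rmorphM -ue -ve mulrACA mulKf.
Qed.

Lemma sparse_ratio_power n w : (0 < n)%N -> sparse_ratio (w ^+ n) n ->
  exists2 c, c != 0 & exists a, w = cstF e c * monF e a.
Proof. by move=> n0 [p [q [p0 q0 pn qn]]]; exact: sparse_power. Qed.

(** As 2 is a fraction with one term, its square root would be some c X^a,
    whence a = 0 and c ^+ 2 = 2 in the rationals. *)
Lemma frac_no_sqrt2 (w : K) : w ^+ 2 != 2%:R.
Proof.
apply/eqP => w2.
have wg : w ^+ 2 * e (gaC G 1) = e (gaC G 2).
  by rewrite !rmorph1 mulr1 w2 -[RHS]/(cstF e 2) rmorph_nat.
have nt c : (nterms (gaC G c) <= 2)%N by apply: leq_trans (nterms_gaMono _ _) _.
have C0 (c : rat) : c != 0 -> gaC G c != 0 by exact: gaMono_neq0.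
have [c c0 [a wE]] :=
  @sparse_power 2 w _ _ isT (C0 2 isT) (C0 1 isT) (nt 2) (nt 1) wg.
have := w2; rewrite wE exprMn -rmorphXn [monF e a ^+ 2]expr2 -monFD.
rewrite -[2%:R](rmorph_nat (cstF e)) -[RHS]mulr1 -(monF0 e).
move/(cst_monF_inj eK (expf_neq0 2 c0)) => [c2 _].
by have := sqr_rat_neq2 c; rewrite c2 eqxx.
Qed.

End SparsePower.

(** * Parity of a space of derivations *)

Section DerivationSpace.
Variable K : fieldType.

Lemma derivationB (d d' : K -> K) : derivation id d -> derivation id d' ->
  derivation id (fun x => d x - d' x).
Proof.
by move=> [dD dM] [d'D d'M]; split=> x y; rewrite ?dD ?d'D ?dM ?d'M; ring.
Qed.

Lemma derivation_comb n (c : 'I_n -> K) (D : 'I_n -> K -> K) :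
  (forall i, derivation id (D i)) ->
  derivation id (fun x => \sum_i c i * D i x).
Proof.
move=> DD; split=> x y.
  by rewrite -big_split; apply: eq_bigr => i _; rewrite (DD i).1 mulrDr.
rewrite mulr_suml mulr_sumr -big_split; apply: eq_bigr => i _.
by rewrite (DD i).2 /=; ring.
Qed.

(** The D i are a basis, dual to the y i, of the derivations that kill S, as
    such a derivation is determined by its values at the y i. *)
Lemma derivation_comb_eq n (S : K -> Prop) (y : 'I_n -> K)
    (D : 'I_n -> K -> K) d :
  (forall i, derivation id (D i)) -> derivation id d ->
  (forall i, y i != 0) -> (forall i j, D i (y j) = (i == j)%:R * y j) ->
  (forall i x, S x -> D i x = 0) -> (forall x, S x -> d x = 0) ->
  (forall d', derivation id d' -> (forall x, S x -> d' x = 0) ->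
    (forall j, d' (y j) = 0) -> forall x, d' x = 0) ->
  forall x, d x = \sum_i d (y i) / y i * D i x.
Proof.
move=> DD dd y0 Dy DS dS uniq x; apply/eqP; rewrite -subr_eq0; apply/eqP.
move: x; apply: uniq => [|x Sx|j].
- exact: derivationB dd (derivation_comb _ DD).
- by rewrite dS// big1 ?subr0// => i _; rewrite DS ?mulr0.
rewrite (bigD1 j)//= Dy eqxx mul1r divfK// big1 ?addr0 ?subrr// => i ij.
by rewrite Dy (negPf ij) mul0r mulr0.
Qed.
End DerivationSpace.

Section Parity.
Variables (G : tfZmodType) (K : fieldType) (e : {rmorphism grpalg rat G -> K}).
Hypotheses (sepG : separated G) (eK : fraction_field e).

(** The logarithmic derivative identifies the derivations of K that kill the
    X^a, a in C, with the additive maps from G to K that vanish on C.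
    Composition with J, which preserves C, is a K-linear endomorphism of this
    space, of matrix M on the basis D, and M ^+ 2 = 2. If the dimension n were
    odd, \det M would give a square root of 2 in K. *)
Lemma even_derivations (J : G -> G) (C : G -> Prop) n
    (y : 'I_n -> K) (D : 'I_n -> K -> K) :
  {morph J : a b / a + b} -> (forall a, J (J a) = a + a) ->
  (forall a, C a -> C (J a)) ->
  (forall i, derivation id (D i)) ->
  (forall i, y i != 0) -> (forall i j, D i (y j) = (i == j)%:R * y j) ->
  (forall i a, C a -> D i (monF e a) = 0) ->
  (forall d, derivation id d -> (forall a, C a -> d (monF e a) = 0) ->
    (forall j, d (y j) = 0) -> forall x, d x = 0) ->
  ~~ odd n.
Proof.
move=> JD JJ CJ DD y0 Dy DC uniq.
have X0 a : monF e a != 0 := monF_neq0 eK a.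
pose S x := exists2 a, C a & x = monF e a.
have DS i x : S x -> D i x = 0 by case=> a Ca ->; exact: DC.
have uniqS d : derivation id d -> (forall x, S x -> d x = 0) ->
    (forall j, d (y j) = 0) -> forall x, d x = 0.
  by move=> dd dS; apply: uniq => // a Ca; apply: dS; exists a.
pose del i a := D i (monF e a) / monF e a.
have delD i : {morph del i : a b / a + b}.
  move=> a b; rewrite /del monFD (DD i).2.
  by field; rewrite !X0.
have DX i a : D i (monF e a) = del i a * monF e a by rewrite /del divfK.
have /choice[E EP] i : exists d : K -> K,
    derivation id d /\ forall a, d (monF e a) = del i (J a) * monF e a.
  have [|d dd dE] := @derivation_of_additive _ _ _ eK (fun a => del i (J a)).
    by move=> a b; rewrite JD delD.
  by exists d.
pose M : 'M[K]_n := \matrix_(i, j) (E i (y j) / y j).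
have EM i x : E i x = \sum_j M i j * D j x.
  rewrite (derivation_comb_eq DD (EP i).1 y0 Dy DS _ uniqS); last first.
    move=> _ [a Ca ->]; rewrite (EP i).2.
    have := DC i (J a) (CJ a Ca); rewrite DX => /eqP.
    by rewrite mulf_eq0 (negPf (X0 _)) orbF => /eqP->; rewrite mul0r.
  by apply: eq_bigr => j _; rewrite mxE.
have delJ i a : del i (J a) = \sum_j M i j * del j a.
  apply: (mulIf (X0 a)); rewrite -(EP i).2 EM mulr_suml; apply: eq_bigr => j _.
  by rewrite DX mulrA.
have delJJ i a : 2%:R * del i a = \sum_j (M *m M) i j * del j a.
  rewrite mulr_natl mulr2n -delD -JJ !delJ.
  under eq_bigr => j _ do rewrite delJ mulr_sumr.
  rewrite exchange_big; apply: eq_bigr => j _; rewrite mxE mulr_suml.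
  by apply: eq_bigr => k _; rewrite mulrA.
have MM : M *m M = 2%:R%:M.
  apply/matrixP => i j; apply: (mulIf (y0 j)).
  pose d x := \sum_k (M *m M - 2%:R%:M) i k * D k x.
  have dd : derivation id d := derivation_comb _ DD.
  have d0 : forall x, d x = 0.
    apply: (@derivation_monF_eq0 _ _ _ eK _ idfun d dd) => a; rewrite /d.
    under eq_bigr => k _ do rewrite DX mulrA.
    rewrite -mulr_suml; under eq_bigr => k _ do rewrite mxE mulrDl.
    rewrite big_split /= -delJJ (bigD1 i)//= big1 ?addr0.
      by rewrite !mxE eqxx mulNr subrr mul0r.
    by move=> k ki; rewrite !mxE eq_sym (negPf ki) oppr0 mul0r.
  have := d0 (y j); rewrite /d (bigD1 j)//= big1 ?addr0; last first.
    by move=> k kj; rewrite Dy (negPf kj) mul0r mulr0.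
  rewrite Dy eqxx mul1r => /eqP; rewrite mulf_eq0 (negPf (y0 j)) orbF mxE.
  by rewrite [X in _ + X]mxE subr_eq0 => /eqP ->.
apply/negP => on; have := congr1 determinant MM.
rewrite det_mulmx det_scalar -expr2 => dM.
have t0 : 2%:R != 0 :> K by rewrite (pcharf0P _).1//; exact: pchar_frac e.
have := frac_no_sqrt2 sepG eK (\det M / 2%:R ^+ n./2); apply/negP.
rewrite negbK expr_div_n dM -{1}(odd_double_half n) on exprD expr1 -exprM.
rewrite muln2 mulfK//.
by rewrite expf_neq0.
Qed.
End Parity.

(** * The group of bounded sequences of elements of Z[sqrt 2] *)

Section ZsqrtTwo.
Variable R : realType.
Local Notation s2 := (Num.sqrt 2 : R).

Lemma sqr_s2 : s2 * s2 = 2.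
Proof. by rewrite -expr2 sqr_sqrtr. Qed.

Lemma Zsqrt2_inj (a b c d : int) :
  a%:~R + b%:~R * s2 = c%:~R + d%:~R * s2 -> a = c /\ b = d.
Proof.
move=> h; have h1 : (a - c)%:~R = (d - b)%:~R * s2.
  by rewrite !intrB; lra.
have db : d - b = 0.
  apply: (@sqr_int_eq2 (a - c)); apply: (@intr_inj R).
  by rewrite !expr2 !intrM h1 mulrACA sqr_s2; ring.
have := h1; rewrite db mul0r => /eqP; rewrite intr_eq0 subr_eq0 => /eqP.
by split=> //; apply/esym/eqP; rewrite -subr_eq0 db.
Qed.

Lemma Zsqrt2_0 : Zsqrt2 (0 : R).
Proof. by exists 0, 0; rewrite mul0r addr0. Qed.

Lemma Zsqrt2_1 : Zsqrt2 (1 : R).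
Proof. by exists 1, 0; rewrite mul0r addr0. Qed.

Lemma Zsqrt2_s2 : Zsqrt2 s2.
Proof. by exists 0, 1; rewrite mul1r add0r. Qed.

Lemma Zsqrt2D (x y : R) : Zsqrt2 x -> Zsqrt2 y -> Zsqrt2 (x + y).
Proof.
move=> [a [b ->]] [c [d ->]]; exists (a + c), (b + d).
by rewrite !intrD; ring.
Qed.

Lemma Zsqrt2M (x y : R) : Zsqrt2 x -> Zsqrt2 y -> Zsqrt2 (x * y).
Proof.
move=> [a [b ->]] [c [d ->]]; exists (a * c + 2 * (b * d)), (a * d + b * c).
transitivity (a%:~R * c%:~R + s2 * s2 * (b%:~R * d%:~R)
                + (a%:~R * d%:~R + b%:~R * c%:~R) * s2); first by ring.
by rewrite sqr_s2 !intrD !intrM.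
Qed.

Lemma Zsqrt2_sum I (r : seq I) (P : pred I) (F : I -> R) :
  (forall i, P i -> Zsqrt2 (F i)) -> Zsqrt2 (\sum_(i <- r | P i) F i).
Proof.
by move=> FO; apply: big_ind => //; [exact: Zsqrt2_0|exact: Zsqrt2D].
Qed.

(** The coordinates on the basis 1, sqrt 2; outside of Z[sqrt 2] the default
    value 0 is used. *)
Definition Zcoord (x : R) : int * int :=
  if pselect (exists c : int * int, x = c.1%:~R + c.2%:~R * s2) is left ex
  then projT1 (cid ex) else 0.

Lemma Zcoord_uniq (a b : int) : Zcoord (a%:~R + b%:~R * s2) = (a, b).
Proof.
rewrite /Zcoord; case: pselect => [ex|[]]; last by exists (a, b).
by case: cid => -[c d] /= /Zsqrt2_inj[-> ->].
Qed.

Lemma ZcoordE (x : R) : Zsqrt2 x ->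
  x = (Zcoord x).1%:~R + (Zcoord x).2%:~R * s2.
Proof. by case=> a [b ->]; rewrite Zcoord_uniq. Qed.

Lemma ZcoordD (x y : R) : Zsqrt2 x -> Zsqrt2 y ->
  Zcoord (x + y) = Zcoord x + Zcoord y.
Proof.
move=> [a [b ->]] [c [d ->]]; rewrite !Zcoord_uniq.
have -> : a%:~R + b%:~R * s2 + (c%:~R + d%:~R * s2) =
    (a + c)%:~R + (b + d)%:~R * s2 by rewrite !intrD; ring.
by rewrite Zcoord_uniq.
Qed.

End ZsqrtTwo.

Section BSeq.
Variable R : realType.
Local Notation s2 := (Num.sqrt 2 : R).
Local Notation A := (bseq_Zsqrt2 R).
Implicit Types (a b : A).

Lemma bseqP a : (forall n, Zsqrt2 (a n)) /\ exists M : R, forall n, `|a n| <= M.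
Proof.
have /asboolP[aZ [M aM]] := valP a.
by split=> //; exists M => n; apply: aM; exists n.
Qed.

Lemma bseqZ a n : Zsqrt2 (a n). Proof. exact: (bseqP a).1. Qed.

Lemma bseq_in (f : nat -> R) : (forall n, Zsqrt2 (f n)) ->
  (exists M : R, forall n, `|f n| <= M) -> f \in @bounded_Zsqrt2 R.
Proof.
move=> fZ [M fM]; apply/asboolP; split=> //.
by exists M => _ [n _ <-].
Qed.

Definition mkbseq f fZ fM : A := BSeqZsqrt2 (@bseq_in f fZ fM).

Lemma bseq_eq a b : (forall n, a n = b n) -> a = b.
Proof. by move=> ab; apply/val_inj/funext. Qed.

Lemma bseqD a b n : (a + b) n = a n + b n.
Proof. by []. Qed.

Lemma bseq0 n : (0 : A) n = 0.
Proof. by []. Qed.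

Lemma bseqMn a k n : (a *+ k) n = a n *+ k.
Proof. by elim: k => [|k IH]; rewrite ?mulr0n// !mulrS bseqD IH. Qed.

Lemma bseqN a n : (- a) n = - a n.
Proof. by []. Qed.

Lemma bseq_sum I (r : seq I) (P : pred I) (F : I -> A) n :
  (\sum_(i <- r | P i) F i) n = \sum_(i <- r | P i) F i n.
Proof.
exact: (big_morph (fun a : A => a n) (fun a b => bseqD a b n) (bseq0 n)).
Qed.

Fact bseqJ_subproof a : (forall n, Zsqrt2 (s2 * a n)) /\
  exists M : R, forall n, `|s2 * a n| <= M.
Proof.
have [aZ [M aM]] := bseqP a; split=> [n|].
  by apply: Zsqrt2M (aZ n); exact: Zsqrt2_s2.
exists (s2 * M) => n.
by rewrite normrM ger0_norm ?sqrtr_ge0// ler_wpM2l ?sqrtr_ge0.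
Qed.

Definition bseqJ a : A := mkbseq (bseqJ_subproof a).1 (bseqJ_subproof a).2.

Lemma bseqJE a n : bseqJ a n = s2 * a n. Proof. by []. Qed.

Lemma bseqJD : {morph bseqJ : a b / a + b}.
Proof.
by move=> a b; apply: bseq_eq => n; rewrite bseqD !bseqJE bseqD mulrDr.
Qed.

Lemma bseqJJ a : bseqJ (bseqJ a) = a + a.
Proof.
by apply: bseq_eq => n; rewrite !bseqJE bseqD mulrA sqr_s2 mulr_natl mulr2n.
Qed.

Fact bseq_trunc_subproof N a :
  (forall n, Zsqrt2 (if (n < N)%N then 0 else a n)) /\
  exists M : R, forall n, `|if (n < N)%N then 0 else a n| <= M.
Proof.
have [aZ [M aM]] := bseqP a; split=> [n|].
  by case: ifP => _ //; exact: Zsqrt2_0.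
exists M => n; case: ifP => _; last exact: aM.
by rewrite normr0; exact: le_trans (aM 0%N).
Qed.

Definition bseq_trunc N a : A :=
  mkbseq (bseq_trunc_subproof N a).1 (bseq_trunc_subproof N a).2.

Lemma bseq_truncE N a n : bseq_trunc N a n = if (n < N)%N then 0 else a n.
Proof. by []. Qed.

Lemma bseq_truncD N : {morph bseq_trunc N : a b / a + b}.
Proof.
move=> a b; apply: bseq_eq => n; rewrite !(bseqD, bseq_truncE).
by case: ifP; rewrite // addr0.
Qed.

Definition tail_from N a := forall n, (n < N)%N -> a n = 0.

Lemma bseq_trunc_tail N a : tail_from N (bseq_trunc N a).
Proof. by move=> n nN; rewrite bseq_truncE nN. Qed.

Lemma bseq_trunc_id N a : tail_from N a -> bseq_trunc N a = a.
Proof.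
by move=> aN; apply: bseq_eq => n; rewrite bseq_truncE; case: ifP => // /aN ->.
Qed.

Lemma tail_from_le N M a : (N <= M)%N -> tail_from M a -> tail_from N a.
Proof. by move=> NM aM n nN; apply: aM; exact: leq_trans NM. Qed.

Lemma tail_fromJ N a : tail_from N a -> tail_from N (bseqJ a).
Proof. by move=> aN n /aN a0; rewrite bseqJE a0 mulr0. Qed.

Fact bseq_unit_subproof (k : nat) : (forall n, Zsqrt2 ((n == k)%:R : R)) /\
  exists M : R, forall n, `|(n == k)%:R : R| <= M.
Proof.
split=> [n|]; first by case: eqP => _; [exact: Zsqrt2_1|exact: Zsqrt2_0].
by exists 1 => n; case: eqP => _; rewrite ?normr1// normr0.
Qed.

Definition bseq_unit k : A :=
  mkbseq (bseq_unit_subproof k).1 (bseq_unit_subproof k).2.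

Lemma bseq_unitE k n : bseq_unit k n = (n == k)%:R. Proof. by []. Qed.

Definition coord n a : int * int := Zcoord (a n).

Lemma coordD n : {morph coord n : a b / a + b}.
Proof. by move=> a b; rewrite /coord bseqD ZcoordD//; exact: bseqZ. Qed.

Lemma coord1D n : {morph (fun a => (coord n a).1) : a b / a + b}.
Proof. by move=> a b; rewrite coordD. Qed.

Lemma coord2D n : {morph (fun a => (coord n a).2) : a b / a + b}.
Proof. by move=> a b; rewrite coordD. Qed.

Lemma coordE n a : a n = (coord n a).1%:~R + (coord n a).2%:~R * s2.
Proof. exact: ZcoordE (bseqZ a n). Qed.

Lemma coord_unit n k : coord n (bseq_unit k) = ((n == k)%:Z, 0).
Proof.
rewrite /coord bseq_unitE -[X in Zcoord X]addr0 -[X in _ + X](mul0r s2).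
by rewrite -(Zcoord_uniq R (n == k)%:Z 0).
Qed.

Lemma coord_Junit n k : coord n (bseqJ (bseq_unit k)) = (0, (n == k)%:Z).
Proof.
rewrite /coord bseqJE bseq_unitE -[X in Zcoord X]add0r mulrC.
by rewrite -(Zcoord_uniq R 0 (n == k)%:Z).
Qed.

Lemma coord_eq0 n a : a n = 0 -> coord n a = 0.
Proof.
move=> a0; rewrite /coord a0 -[X in Zcoord X]addr0 -[X in _ + X](mul0r s2).
by rewrite -[RHS](Zcoord_uniq R 0 0).
Qed.

Lemma bseq_separated : separated A.
Proof.
move=> a a0; have [n an0] : exists n, a n != 0.
  apply: contrapT => nex; case/eqP: a0; apply: bseq_eq => n; rewrite bseq0.
  by apply/eqP; apply: contrapT => /negP an; apply: nex; exists n.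
have [c1|c1] := eqVneq (coord n a).1 0; last first.
  by exists (fun a => (coord n a).1) => //; exact: coord1D.
exists (fun a => (coord n a).2); first exact: coord2D.
by apply: contra_neq an0 => c2; rewrite coordE c1 c2 mul0r addr0.
Qed.

Lemma bseq_head_tail N a :
  a = \sum_(i < N) (bseq_unit i *~ (coord i a).1
                    + bseqJ (bseq_unit i) *~ (coord i a).2) + bseq_trunc N a.
Proof.
have Mz (b : A) (z : int) n : (b *~ z) n = b n *~ z.
  case: z => k; first by rewrite -!pmulrn bseqMn.
  by rewrite !NegzE !mulrNz bseqN -!pmulrn bseqMn.
apply: bseq_eq => n; rewrite bseqD bseq_truncE bseq_sum.
have F i :
    (bseq_unit i *~ (coord i a).1 + bseqJ (bseq_unit i) *~ (coord i a).2) n =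
    (n == i)%:R * a i.
  rewrite bseqD !Mz bseqJE bseq_unitE [a i]coordE.
  by case: eqP => _; rewrite ?mulr0 ?mul0rz ?mul0r ?addr0// mulr1 mul1r mulrzl.
under eq_bigr => i _ do rewrite F.
case: ltnP => nN.
  rewrite addr0 (bigD1 (Ordinal nN))//= eqxx mul1r big1 ?addr0// => i ni.
  suff /negPf -> : n != i by rewrite mul0r.
  by apply: contra_neq ni => ni; apply: val_inj.
rewrite big1 ?add0r// => i _.
suff /negPf -> : n != i by rewrite mul0r.
by rewrite neq_ltn (leq_trans (ltn_ord i) nN) orbT.
Qed.

End BSeq.

Section Shift.
Variable R : realType.
Local Notation s2 := (Num.sqrt 2 : R).
Local Notation A := (bseq_Zsqrt2 R).
Implicit Types (a b : A).

Fact bseq_behead_subproof a : (forall n, Zsqrt2 (a n.+1)) /\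
  exists M : R, forall n, `|a n.+1| <= M.
Proof. by have [aZ [M aM]] := bseqP a; split=> // ; exists M. Qed.

Definition bseq_behead a : A :=
  mkbseq (bseq_behead_subproof a).1 (bseq_behead_subproof a).2.

Fact bseq_cons0_subproof a :
  (forall n, Zsqrt2 (if n is m.+1 then a m else 0)) /\
  exists M : R, forall n, `|if n is m.+1 then a m else 0| <= M.
Proof.
have [aZ [M aM]] := bseqP a; split=> [[|n]//|]; first exact: Zsqrt2_0.
by exists M => -[|n] //; rewrite normr0; exact: le_trans (aM 0%N).
Qed.

Definition bseq_cons0 a : A :=
  mkbseq (bseq_cons0_subproof a).1 (bseq_cons0_subproof a).2.

Lemma bseq_beheadD : {morph bseq_behead : a b / a + b}.
Proof. by move=> a b; apply: bseq_eq. Qed.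

Lemma bseq_cons0D : {morph bseq_cons0 : a b / a + b}.
Proof. by move=> a b; apply: bseq_eq => -[|n] //; rewrite bseqD /= addr0. Qed.

Lemma bseq_cons0K a : bseq_behead (bseq_cons0 a) = a.
Proof. exact: bseq_eq. Qed.

Lemma bseq_behead_unit0 : bseq_behead (bseq_unit R 0) = 0.
Proof. exact: bseq_eq. Qed.

Lemma bseq_behead_Junit0 : bseq_behead (bseqJ (bseq_unit R 0)) = 0.
Proof. by apply: bseq_eq => n /=; rewrite mulr0. Qed.

Lemma coord0_cons0 a : coord 0 (bseq_cons0 a) = 0.
Proof. exact: coord_eq0. Qed.

Lemma bseq_behead_cons a : a = bseq_cons0 (bseq_behead a)
  + bseq_unit R 0 *~ (coord 0 a).1 + bseqJ (bseq_unit R 0) *~ (coord 0 a).2.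
Proof.
rewrite [LHS](bseq_head_tail 1) big_ord1 addrC -addrA; congr (_ + _).
by apply: bseq_eq => -[|n].
Qed.

(** The family e_0, sqrt 2 e_0, e_1, sqrt 2 e_1, ... where e_k is the sequence
    with a single 1 in place k. *)
Definition bseq_gen k : A :=
  if odd k then bseqJ (bseq_unit R k./2) else bseq_unit R k./2.

Definition bseq_gencoord k a : int :=
  if odd k then (coord k./2 a).2 else (coord k./2 a).1.

Lemma bseq_gencoordD k : {morph bseq_gencoord k : a b / a + b}.
Proof.
by move=> a b; rewrite /bseq_gencoord; case: ifP => _; rewrite coordD.
Qed.

Lemma bseq_gencoord_gen k k' : bseq_gencoord k (bseq_gen k') = (k == k')%:Z.
Proof.
have kE : (k == k') = (odd k == odd k') && (k./2 == k'./2).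
  apply/eqP/andP => [->//|[/eqP o /eqP h]].
  by rewrite -[k]odd_double_half -[k']odd_double_half o h.
rewrite /bseq_gencoord /bseq_gen kE.
by case: (odd k); case: (odd k'); rewrite ?coord_unit ?coord_Junit.
Qed.

Lemma bseq_gencoord_tail N a k :
  tail_from N a -> (k < N.*2)%N -> bseq_gencoord k a = 0.
Proof.
move=> aN kN; rewrite /bseq_gencoord coord_eq0 ?if_same//.
apply: aN; rewrite -ltn_double (leq_ltn_trans _ kN)//.
by rewrite -{2}[k]odd_double_half leq_addl.
Qed.

Lemma bseq_gen_tail N a :
  a = \sum_(k < N.*2) bseq_gen k *~ bseq_gencoord k a + bseq_trunc N a.
Proof.
rewrite [LHS](bseq_head_tail N); congr (_ + _).
rewrite -(big_mkord xpredT (fun k => bseq_gen k *~ bseq_gencoord k a)).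
rewrite -(big_mkord xpredT (fun i => bseq_unit R i *~ (coord i a).1
                    + bseqJ (bseq_unit R i) *~ (coord i a).2)).
elim: N => [|N IH]; first by rewrite !big_geq.
rewrite big_nat_recr//= IH doubleS !big_nat_recr//= -addrA; congr (_ + (_ + _)).
  by rewrite /bseq_gen /bseq_gencoord odd_double doubleK.
by rewrite /bseq_gen /bseq_gencoord /= odd_double uphalf_double.
Qed.

End Shift.

(** * Gliding humps *)

(** Each choice may depend on the sum of the terms chosen before and on an
    integer passed on from the preceding choice. *)
Lemma dependent_choice_sum (V : zmodType)
    (P : nat -> V -> nat -> V -> nat -> Prop) :
  (forall j p c, exists a c', P j p c a c') ->
  exists (a : nat -> V) (c : nat -> nat), c 0%N = 1%N /\
    forall j, P j (\sum_(0 <= i < j) a i) (c j) (a j) (c j.+1).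
Proof.
move=> ex; have /choice[F FP] (x : nat * (V * nat)) : exists y : V * nat,
    P x.1 x.2.1 x.2.2 y.1 y.2.
  by have [a [c' aP]] := ex x.1 x.2.1 x.2.2; exists (a, c').
pose st := fix st j : V * nat := if j is j'.+1 then
  let y := F (j', st j') in ((st j').1 + y.1, y.2) else (0, 1%N).
exists (fun j => (F (j, st j)).1), (fun j => (st j).2); split=> // j.
have -> : \sum_(0 <= i < j) (F (i, st i)).1 = (st j).1.
  elim: j => [|j IH]; first by rewrite big_geq.
  by rewrite big_nat_recr//= IH.
exact: FP (j, st j).
Qed.

(** For an additive map from G to a group with an integral norm, let S a n say
    that the image of a has norm less than n, and let M be the kernel; the
    conclusion is that the map vanishes on some tail. By the triangle
    inequality the norm of a difference is less than the product of the
    bounds. As S and M alone are mentioned, the statement applies to maps to Z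
    and to maps to the multiplicative group of a field modulo monomials. *)
Definition gliding_hump (G : zmodType) (tail : nat -> G -> Prop) :=
  forall (S : G -> nat -> Prop) (M : G -> Prop),
  (forall a, exists n, S a n) ->
  (forall a n n', (n <= n')%N -> S a n -> S a n') ->
  (forall a b n n', S a n -> S b n' -> S (a - b) (n * n')%N) ->
  (forall a n, (0 < n)%N -> S (a *+ n) n -> M a) ->
  (forall a b, M a -> M b -> M (a - b)) ->
  exists N, forall a, tail N a -> M a.

Section GlidingHump.
Variable R : realType.
Local Notation s2 := (Num.sqrt 2 : R).
Local Notation A := (bseq_Zsqrt2 R).
Implicit Types (a b : A).

Lemma bseq_natbound a : exists B : nat, forall n, `|a n| <= B%:R.
Proof.
have [_ [M aM]] := bseqP a; exists (Num.bound M) => n.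
have M0 : 0 <= M by exact: le_trans (aM 0%N).
by apply: le_trans (aM n) (ltW _); rewrite archi_boundP.
Qed.

Lemma bseqB a b n : (a - b) n = a n - b n.
Proof. by []. Qed.

(** At each place finitely many terms only are nonzero, and the sum is bounded
    by a geometric series. *)
Lemma bseq_infinite_sum (a : nat -> A) : (forall j, tail_from j (a j)) ->
  (forall j n, `|a j n| <= 2^-1 ^+ j) ->
  exists s : A, forall k n,
    (s - \sum_(0 <= i < k) a i) n = \sum_(k <= i < n.+1) a i n.
Proof.
move=> a_tail a_small; pose f n := \sum_(0 <= i < n.+1) a i n.
have fZ n : Zsqrt2 (f n) by apply: Zsqrt2_sum => i _; exact: bseqZ.
have fM : exists M : R, forall n, `|f n| <= M.
  exists 2 => n; rewrite (le_trans (ler_norm_sum _ _ _))//.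
  apply: le_trans (_ : \sum_(0 <= i < n.+1) 2^-1 ^+ i <= _).
    by apply: ler_sum => i _; exact: a_small.
  have -> : \sum_(0 <= i < n.+1) 2^-1 ^+ i = 2 - 2^-1 ^+ n :> R.
    elim: n => [|n IH]; first by rewrite big_nat1 !expr0; lra.
    by rewrite big_nat_recr//= IH exprS; lra.
  by rewrite gerBl exprn_ge0// invr_ge0.
exists (mkbseq fZ fM) => k n; rewrite bseqB bseq_sum /= /f.
have [kn|nk] := leqP k n.+1.
  by rewrite (big_cat_nat (leq0n k) kn)/= [_ + _ - _]addrC addKr.
rewrite [RHS]big_geq ?(ltnW nk)// (big_cat_nat (leq0n n.+1) (ltnW nk))/=.
rewrite opprD addrA subrr sub0r big_nat big1 ?oppr0// => i /andP[ni _].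
by rewrite a_tail.
Qed.

Lemma bseq_divisible a m (x : nat -> R) : (0 < m)%N ->
  (forall n, Zsqrt2 (x n)) ->
  (forall n, a n = x n *+ m) -> exists t, a = t *+ m.
Proof.
move=> m0 xZ ax; have [_ [M aM]] := bseqP a.
have xM : exists M : R, forall n, `|x n| <= M.
  exists M => n; apply: le_trans (aM n); rewrite ax normrMn.
  by rewrite -mulr_natr ler_peMr// ler1n.
by exists (mkbseq xZ xM); apply: bseq_eq => n; rewrite bseqMn ax.
Qed.

(** Multiplication by sqrt 2 - 1, a unit of Z[sqrt 2] less than 1/2 whose
    conjugate - (sqrt 2 + 1) exceeds 2 in absolute value. *)
Definition bseq_eps a : A := bseqJ a - a.

Lemma bseq_epsE a n : bseq_eps a n = (s2 - 1) * a n.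
Proof. by rewrite bseqB bseqJE mulrBl mul1r. Qed.

Lemma iter_epsE u a n : iter u bseq_eps a n = (s2 - 1) ^+ u * a n.
Proof.
by elim: u => [|u IH]; rewrite ?mul1r// iterS bseq_epsE IH mulrA exprS.
Qed.

Lemma tail_from_eps u N a : tail_from N a -> tail_from N (iter u bseq_eps a).
Proof. by move=> aN n nN; rewrite iter_epsE aN// mulr0. Qed.

Lemma bseq_eps_eps a : bseq_eps (bseq_eps a) = a - bseq_eps a - bseq_eps a.
Proof.
apply: bseq_eq => n; rewrite !bseqB !bseqJE !bseqB !bseqJE.
rewrite mulrBr mulrA sqr_s2; ring.
Qed.

Lemma s2_bounds : 1 <= s2 <= 3 / 2.
Proof.
have s0 : 0 <= s2 := sqrtr_ge0 _; have := sqr_s2 R.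
by move: s0; set x := s2 => x0 xx; apply/andP; split; nra.
Qed.

Lemma iter_eps_small a m j : exists u0, forall u n, (u0 <= u)%N ->
  `|(iter u bseq_eps a *+ m) n| <= 2^-1 ^+ j.
Proof.
(* The unit is less than 1/2, and x <= 2 ^ x. *)
have [B aB] := bseq_natbound a; exists (B * m * 2 ^ j)%N => u n le_u.
have /andP[s1 s32] := s2_bounds.
rewrite bseqMn iter_epsE normrMn normrM normrX ger0_norm; last by lra.
rewrite -[_ *+ m]mulr_natr -mulrA.
apply: le_trans (_ : 2^-1 ^+ u * (B * m)%:R <= _).
  rewrite ler_pM ?exprn_ge0 ?mulr_ge0//; first by lra.
    by rewrite lerXn2r ?nnegrE ?invr_ge0//; lra.
  by rewrite natrM ler_wpM2r.
rewrite !exprVn -ler_pdivlMl ?invr_gt0 ?exprn_gt0// invrK.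
rewrite ler_pdivlMr ?exprn_gt0//.
rewrite -!natrX -natrM ler_nat; apply: leq_trans le_u _.
exact: ltnW (ltn_expl _ _).
Qed.

Section Subgroup.
Variable M : A -> Prop.
Hypothesis MB : forall a b, M a -> M b -> M (a - b).

Lemma subgroup0 a : M a -> M 0.
Proof. by move=> Ma; rewrite -(subrr a); exact: MB. Qed.

Lemma subgroupD a b : M a -> M b -> M (a + b).
Proof.
move=> Ma Mb; rewrite -[b]opprK -[- b]sub0r.
by do !apply: MB => //; exact: subgroup0 Ma.
Qed.

Lemma subgroupMn a d : M a -> M (a *+ d).
Proof.
move=> Ma; elim: d => [|d IH]; first exact: subgroup0 Ma.
by rewrite mulrS; exact: subgroupD.
Qed.

(** The unit e = sqrt 2 - 1 satisfies 1 = e ^+ 2 + e + e, so that e ^+ u a is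
    recovered from the next two multiples. Small elements outside of M are
    obtained in this way although M need not be stable under sqrt 2. *)
Lemma iter_eps_outside a u : ~ M a ->
  ~ M (iter u bseq_eps a) \/ ~ M (iter u.+1 bseq_eps a).
Proof.
move=> nMa; elim: u => [|u [] nM]; [by left| |by left].
have [M1|] := pselect (M (iter u.+1 bseq_eps a)); last by left.
right=> M2; apply: nM.
have -> : iter u bseq_eps a =
    iter u.+2 bseq_eps a + iter u.+1 bseq_eps a + iter u.+1 bseq_eps a.
  by rewrite [iter u.+2 _ _]bseq_eps_eps -/(iter u.+1 _ _) !subrK.
exact: subgroupD (subgroupD M2 M1) M1.
Qed.
End Subgroup.

(** If all tails had elements outside of M, some b_j in the j-th tail could be
    chosen outside of M, together with integers c_(j+1), each a multiple of
    the former, much larger than the size of p_j, the sum of the b_i c_(i+1)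
    for i < j. Thanks to the small units b_j can be so small that the series
    converges, to s say. Then s - p_j = t_j c_(j+1) for some t_j, and the left
    hand side has size at most c_(j+1) for j large, so that t_j lies in M. But
    b_j is t_j minus a multiple of t_(j+1). *)
Lemma discrete_gliding_hump : gliding_hump (@tail_from R).
Proof.
move=> S M Sex Sle SB SM MB; apply: contrapT => nex.
have {}nex N : exists2 a, tail_from N a & ~ M a.
  apply: contrapT => nN; apply: nex; exists N => a aN.
  by apply: contrapT => nMa; apply: nN; exists a.
pose P j p c a c' := [/\ exists b n, [/\ S p n, (0 < n)%N,
    c' = (c * (j.+1 * n))%N, a = b *+ c' & ~ M b], tail_from j a &
    forall n, `|a n| <= 2^-1 ^+ j].
have [j p c|a [c [c0 aP]]] := @dependent_choice_sum A P.
  have [n0 Sp] := Sex p; have [a0 a0j nMa0] := nex j.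
  (* The factor j.+1 will absorb the size of the whole sum. *)
  pose c' := (c * (j.+1 * n0.+1))%N.
  have [u0 small] := iter_eps_small a0 c' j.
  have [u [le_u nMb]] : exists u, (u0 <= u)%N /\ ~ M (iter u bseq_eps a0).
    by have [] := iter_eps_outside MB u0 nMa0; [exists u0|exists u0.+1; split].
  exists (iter u bseq_eps a0 *+ c'), c'; split=> [||n]; last exact: small.
    by exists (iter u bseq_eps a0), n0.+1; split=> //; exact: Sle (leqnSn _) Sp.
  by move=> n nj; rewrite bseqMn (tail_from_eps _ a0j)// mul0rn.
have [s sE] := bseq_infinite_sum (fun j => let: And3 _ h _ := aP j in h)
  (fun j => let: And3 _ _ h := aP j in h).
pose p k := \sum_(0 <= i < k) a i.
have /choice[b bP] j : exists b, [/\ a j = b *+ c j.+1, ~ M b &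
    exists n, [/\ S (p j) n, (0 < n)%N & c j.+1 = (c j * (j.+1 * n))%N]].
  by have [[b [n [? ? ? ? ?]]] _ _] := aP j; exists b; split=> //; exists n.
have c_gt0 j : (0 < c j)%N.
  elim: j => [|j IH]; first by rewrite c0.
  by have [_ _ [n [_ n0 ->]]] := bP j; rewrite !muln_gt0 IH n0.
have c_dvd i j : (i <= j)%N -> (c i %| c j)%N.
  move/subnK <-; elim: (j - i)%N => // k IH; rewrite addSn.
  apply: dvdn_trans IH _; have [_ _ [n [_ _ ->]]] := bP (k + i)%N.
  exact: dvdn_mulr.
have /choice[t tE] k : exists t, s - p k = t *+ c k.+1.
  apply: (bseq_divisible (c_gt0 _)
    (x := fun n => \sum_(k <= i < n.+1) b i n *+ (c i.+1 %/ c k.+1))) => [n|n].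
    apply: Zsqrt2_sum => i _; rewrite -bseqMn; exact: bseqZ.
  rewrite sE -sumrMnl; apply: eq_big_nat => i /andP[ki _].
  by have [-> _ _] := bP i; rewrite bseqMn -mulrnA divnK// c_dvd.
have [ns Ss] := Sex s.
have Mt k : (ns <= k)%N -> M (t k).
  move=> nsk; apply: (SM _ (c k.+1)) => //; rewrite -tE.
  have [_ _ [n [Sp n0 ->]]] := bP k; apply: Sle (SB _ _ _ _ Ss Sp).
  by rewrite mulnA leq_mul2r (leq_trans (leqW nsk)) ?orbT// leq_pmull.
have [ab nMb _] := bP ns; apply: nMb.
have dvd_c : (c ns.+1 %| c ns.+2)%N by rewrite c_dvd.
have -> : b ns = t ns - t ns.+1 *+ (c ns.+2 %/ c ns.+1).
  have tf (x : A) : x *+ c ns.+1 = 0 -> x = 0.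
    by rewrite -(prednK (c_gt0 ns.+1)) => /bseq_Zsqrt2_tf.
  apply/eqP; rewrite -subr_eq0; apply/eqP/tf.
  rewrite !mulrnBl -mulrnA divnK// -!tE -ab /p big_nat_recr//=.
  by rewrite [- (_ + a ns)]opprD [s + (_ - _)]addrA subKr subrr.
by apply: (MB); [exact: Mt|exact: (subgroupMn MB _ (Mt _ (leqnSn ns)))].
Qed.

(** D is semilinear with respect to conjugation: when a is multiplied by the
    small unit sqrt 2 - 1, D a is multiplied by - (sqrt 2 + 1). If D is
    nonzero on all tails, there are small elements in arbitrarily far tails
    whose images are large in some place n. The coordinate of place n vanishes
    on a tail by hypothesis, and the following terms are taken in that tail.
    The image of the sum of these terms would then be unbounded. *)
Lemma twisted_gliding_hump (D : A -> A) : {morph D : a b / a + b} ->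
  (forall a, D (bseqJ a) = - bseqJ (D a)) ->
  (forall n, exists N, forall a, tail_from N a -> D a n = 0) ->
  exists N, forall a, tail_from N a -> D a = 0.
Proof.
move=> DD DJ D0; apply: contrapT => nex.
have {}nex N : exists2 a, tail_from N a & exists n, D a n != 0.
  apply: contrapT => nN; apply: nex; exists N => a aN; apply: bseq_eq => n.
  apply/eqP; apply: contrapT => /negP Dan; apply: nN; exists a => //.
  by exists n.
have Deps u a n : D (iter u bseq_eps a) n = (- (s2 + 1)) ^+ u * D a n.
  elim: u => [|u IH]; first by rewrite mul1r.
  rewrite iterS /bseq_eps (morphDB DD) DJ bseqB bseqN bseqJE IH exprS; ring.
(* c is a place from which the terms may start without changing the
   coordinates of D selected so far. *)
pose P j p c a c' := [/\ tail_from j a, tail_from c a, (c <= c')%N,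
  (exists n, j%:R <= `|D (p + a) n| /\ forall x, tail_from c' x -> D x n = 0) &
  forall n, `|a n| <= 2^-1 ^+ j].
have [j p c|a [c [c0 aP]]] := @dependent_choice_sum A P.
  have [a0 a0t [n Dn]] := nex (maxn j c).
  have [N DN] := D0 n.
  have [u0 small] := iter_eps_small a0 1 j.
  have [u [le_u big_u]] : exists u, (u0 <= u)%N /\
      j%:R <= `|D (p + iter u bseq_eps a0) n|.
    have [B Bp] := bseq_natbound (D p).
    set d := `|D a0 n|; have d0 : 0 < d by rewrite normr_gt0.
    pose u1 := Num.bound ((j%:R + B%:R) / d); exists (maxn u0 u1).
    split; first exact: leq_maxl.
    rewrite DD bseqD Deps addrC; apply: le_trans (lerB_normD _ _).
    rewrite lerBrDr normrM normrX normrN.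
    have /andP[s1 _] := s2_bounds.
    apply: le_trans (_ : j%:R + B%:R <= _); first by rewrite lerD2l.
    have q0 : 0 <= (j%:R + B%:R) / d by rewrite divr_ge0 ?(ltW d0)// addr_ge0.
    rewrite -ler_pdivrMr// -/d; apply: le_trans (ltW (archi_boundP q0)) _.
    apply: le_trans (_ : 2 ^+ maxn u0 u1 <= _); last first.
      by rewrite lerXn2r ?nnegrE ?ger0_norm//; lra.
    rewrite -natrX ler_nat; apply: leq_trans (leq_maxr u0 _) _.
    exact: ltnW (ltn_expl _ _).
  exists (iter u bseq_eps a0), (maxn c N); split.
  - by apply: tail_from_eps; apply: tail_from_le a0t; exact: leq_maxl.
  - by apply: tail_from_eps; apply: tail_from_le a0t; exact: leq_maxr.
  - exact: leq_maxl.
  - exists n; split=> // x xt; apply: DN.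
    apply: tail_from_le xt; exact: leq_maxr.
  - by move=> m; have := small u m le_u; rewrite mulr1n.
have [s sE] := bseq_infinite_sum (fun j => let: And5 h _ _ _ _ := aP j in h)
  (fun j => let: And5 _ _ _ _ h := aP j in h).
have c_le i j : (i <= j)%N -> (c i <= c j)%N.
  move/subnK <-; elim: (j - i)%N => // k IH; rewrite addSn.
  by apply: leq_trans IH _; have [] := aP (k + i)%N.
have [B DsB] := bseq_natbound (D s).
have [_ _ _ [n [jn Dn]] _] := aP B.+1.
have := DsB n.
have -> : s = (\sum_(0 <= i < B.+1) a i + a B.+1)
    + (s - \sum_(0 <= i < B.+2) a i).
  by rewrite -big_nat_recr//= addrCA subrr addr0.
rewrite DD bseqD [X in _ + X]Dn; last first.
  move=> m mc; rewrite sE big_nat big1// => i /andP[Bi _].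
  by have [_ ai _ _ _] := aP i; apply: ai; exact: leq_trans mc (c_le _ _ _).
rewrite addr0 => h; have := le_trans jn h; rewrite ler_nat ltnn.
by [].
Qed.

End GlidingHump.

(** * F and F(x) are not isomorphic *)

Section TailLinear.
Variable R : realType.
Local Notation A := (bseq_Zsqrt2 R).
Implicit Types (a b : A).

(** The absolute value is a discrete norm on Z. *)
Lemma additive_int_tail (l : A -> int) : {morph l : a b / a + b} ->
  exists N, forall a, tail_from N a -> l a = 0.
Proof.
move=> lD.
apply: (@discrete_gliding_hump _
  (fun a n => (absz (l a) < n)%N) (fun a => l a = 0)).
- by move=> a; exists (absz (l a)).+1.
- by move=> a n n' nn' la; exact: leq_trans nn'.
- by move=> a b n n'; rewrite (morphDB lD) => la lb; nia.
- by move=> a n n0; rewrite (morphDMn lD) -mulr_natr abszM; nia.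
- by move=> a b la lb; rewrite (morphDB lD) la lb subr0.
Qed.

(** The commutator of T and J anticommutes with J, and twisted_gliding_hump
    applies to it; the hypothesis on its coordinates is additive_int_tail. *)
Lemma tail_J_linear (T : A -> A) : {morph T : a b / a + b} ->
  exists N, forall a, tail_from N a -> T (bseqJ a) = bseqJ (T a).
Proof.
move=> TD; pose D a := T (bseqJ a) - bseqJ (T a).
have JN a : bseqJ (- a) = - bseqJ a := morphDN (@bseqJD R) a.
have DD : {morph D : a b / a + b}.
  by move=> a b; rewrite /D bseqJD !TD bseqJD opprD addrACA.
have DJ a : D (bseqJ a) = - bseqJ (D a).
  rewrite /D bseqJJ TD bseqJD JN bseqJJ opprD opprK.
  by rewrite addrC.
have D_coord n : exists N, forall a, tail_from N a -> D a n = 0.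
  have [|M1 H1] := @additive_int_tail (fun a => (coord n (D a)).1).
    by move=> a b; rewrite DD coord1D.
  have [|M2 H2] := @additive_int_tail (fun a => (coord n (D a)).2).
    by move=> a b; rewrite DD coord2D.
  exists (maxn M1 M2) => a at0; rewrite coordE H1 ?H2 ?mul0r ?addr0//.
    exact: tail_from_le (leq_maxr _ _) at0.
  exact: tail_from_le (leq_maxl _ _) at0.
have [N D0] := twisted_gliding_hump DD DJ D_coord.
by exists N => a aN; apply/eqP; rewrite -subr_eq0 -/(D a) D0.
Qed.
End TailLinear.

Section CharacterTail.
Variables (G : tfZmodType) (K : fieldType) (e : {rmorphism grpalg rat G -> K}).
Hypotheses (sepG : separated G) (eK : fraction_field e).
Variable theta : G -> K.
Hypothesis theta0 : forall a, theta a != 0.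
Hypothesis thetaD : forall a b, theta (a + b) = theta a * theta b.

Lemma theta_B a b : theta (a - b) = theta a / theta b.
Proof. by rewrite -[a in RHS](subrK b) [in RHS]thetaD mulfK. Qed.

Lemma theta_Mn a n : theta (a *+ n) = theta a ^+ n.
Proof.
elim: n => [|n IH]; last by rewrite mulrS thetaD IH exprS.
by apply: (mulIf (theta0 0)); rewrite mulr0n expr0 -thetaD addr0 mul1r.
Qed.

(** Modulo monomials, theta is an additive map to a group with a discrete
    norm, where sparse_ratio measures size. *)
Lemma character_monomial_tail (tail : nat -> G -> Prop) : gliding_hump tail ->
  exists N, forall a, tail N a ->
    exists b, exists2 c, c != 0 & theta a = cstF e c * monF e b.
Proof.
move=> hump; apply: (hump (fun a n => sparse_ratio e (theta a) n)).
- by move=> a; exact: sparse_ratio_exists.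
- by move=> a n n'; exact: sparse_ratio_le.
- by move=> a b n n'; rewrite theta_B; exact: sparse_ratio_div.
- move=> a n n0; rewrite theta_Mn => ta.
  have [c c0 [b tE]] := sparse_ratio_power sepG eK n0 ta.
  by exists b, c.
move=> a a' [b [c c0 tE]] [b' [c' c'0 tE']]; exists (b - b'), (c / c').
  by rewrite mulf_neq0// invr_eq0.
by rewrite theta_B tE tE' cst_monF_div.
Qed.

Lemma character_exponent (P : G -> G) : {morph P : a b / a + b} ->
  (forall a, exists b, exists2 c, c != 0 & theta (P a) = cstF e c * monF e b) ->
  exists2 T : G -> G, {morph T : a b / a + b} &
    forall a, exists2 c, c != 0 & theta (P a) = cstF e c * monF e (T a).
Proof.
move=> PD /choice[T TP]; exists T => // a b.
have [c c0 E] := TP (a + b); have [ca ca0 Ea] := TP a; have [cb cb0 Eb] := TP b.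
by apply: (cst_monF_mul_eq eK ca0 cb0 (d := c)); rewrite -E -Ea -Eb -thetaD PD.
Qed.
End CharacterTail.

Section PolyDerivation.
Variables (K : idomainType) (d : K -> K) (c : K).
Hypothesis dd : derivation id d.

(** The extension of d that multiplies 'X by c. *)
Definition twisted_poly_der (p : {poly K}) : {poly K} :=
  map_poly d p + c *: ('X * p^`()).

Let d0 : d 0 = 0 := morphD0 dd.1.

Lemma map_poly_derivation : derivation id (map_poly d).
Proof.
split=> p q; apply/polyP => i; rewrite !(coefD, coef_map_id0)//.
  by rewrite dd.1.
rewrite !coefM (morphD_sum dd.1) -big_split; apply: eq_bigr => j _.
by rewrite !coef_map_id0// dd.2.
Qed.

Lemma twisted_poly_der_derivation : derivation id twisted_poly_der.
Proof.
have [mD mM] := map_poly_derivation.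
split=> p q; rewrite /twisted_poly_der.
  by rewrite mD derivD mulrDr scalerDr addrACA.
by rewrite mM derivM -!mul_polyC; ring.
Qed.

Lemma twisted_poly_derC a : twisted_poly_der a%:P = (d a)%:P.
Proof.
rewrite /twisted_poly_der derivC mulr0 scaler0 addr0; apply/polyP => i.
by rewrite coef_map_id0// !coefC; case: ifP.
Qed.

Lemma twisted_poly_derX : twisted_poly_der 'X = c%:P * 'X.
Proof.
rewrite /twisted_poly_der derivX mulr1 mul_polyC; apply/polyP => i.
rewrite coefD coef_map_id0// coefX; case: eqP => _; last by rewrite d0 add0r.
by rewrite (@derivation1 _ _ idfun d dd) add0r.
Qed.

Lemma ratfun_derivation (L : fieldType) (i : {rmorphism {poly K} -> L}) :
  fraction_field i -> exists D : L -> L, [/\ derivation id D,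
    forall a, D (i a%:P) = i (d a)%:P & D (i 'X) = i c%:P * i 'X].
Proof.
move=> iL; have [|D DD DE] :=
  @frac_derivation _ _ _ iL (fun p => i (twisted_poly_der p)).
  have [pD pM] := twisted_poly_der_derivation.
  by split=> p q; rewrite ?pD ?pM rmorphD 2?rmorphM.
exists D; split=> //; first by move=> a; rewrite DE twisted_poly_derC.
by rewrite DE twisted_poly_derX rmorphM.
Qed.
End PolyDerivation.

Lemma derivation_ratfun_eq0 (K L : fieldType)
    (i : {rmorphism {poly K} -> L}) D :
  fraction_field i -> derivation id D -> (forall a, D (i a%:P) = 0) ->
  D (i 'X) = 0 -> forall x, D x = 0.
Proof.
move=> iL DD DC DX; apply: (@derivation_frac_eq0 _ _ i iL _ idfun D DD) => p.
elim/poly_ind: p => [|p c IH]; first by rewrite rmorph0 (morphD0 DD.1).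
by rewrite rmorphD rmorphM DD.1 DD.2 IH DX DC mul0r mulr0 !addr0.
Qed.

Lemma bij_rmorphism (K L : fieldType) (f : {rmorphism K -> L}) : bijective f ->
  exists g : {rmorphism L -> K}, cancel f g /\ cancel g f.
Proof.
case=> g fK gK; pose h := g.
have HB : zmod_morphism h.
  by move=> x y; apply: (can_inj fK); rewrite rmorphB /h !gK.
have HM : monoid_morphism h.
  split=> [|x y]; apply: (can_inj fK); first by rewrite /h gK rmorph1.
  by rewrite rmorphM /h !gK.
pose HA := GRing.isZmodMorphism.Build _ _ h HB.
pose HM' := GRing.isMonoidMorphism.Build _ _ h HM.
pose H' : {rmorphism L -> K} := HB.pack h HA HM'.
by exists H'.
Qed.

(** G stands for the group of bounded sequences, J for multiplication by sqrt
    2, u for the family e_0, sqrt 2 e_0, e_1, ... and l for the coordinates on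
    it. What is needed of real analysis is contained in hump and tail_lin. *)
Section NoIsomorphism.
Variables (G : tfZmodType) (J : G -> G) (tail : nat -> G -> Prop).
Variables (trunc : nat -> G -> G) (u : nat -> G) (l : nat -> G -> int).
Hypotheses (sepG : separated G)
  (JD : {morph J : a b / a + b}) (JJ : forall a, J (J a) = a + a)
  (tailJ : forall N a, tail N a -> tail N (J a))
  (tail_le : forall N M a, (N <= M)%N -> tail M a -> tail N a)
  (truncD : forall N, {morph trunc N : a b / a + b})
  (trunc_tail : forall N a, tail N (trunc N a))
  (trunc_id : forall N a, tail N a -> trunc N a = a)
  (lD : forall k, {morph l k : a b / a + b})
  (lu : forall k k', l k (u k') = (k == k')%:Z)
  (l_tail : forall N a k, tail N a -> (k < N.*2)%N -> l k a = 0)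
  (head_tail : forall N a, a = \sum_(k < N.*2) u k *~ l k a + trunc N a)
  (hump : gliding_hump tail)
  (tail_lin : forall T : G -> G, {morph T : a b / a + b} ->
     exists N, forall a, tail N a -> T (J a) = J (T a)).

Variables (K : fieldType) (e : {rmorphism grpalg rat G -> K}).
Variables (L : fieldType) (i : {rmorphism {poly K} -> L}).
Hypotheses (eK : fraction_field e) (iL : fraction_field i).

Let kappa a : L := i (monF e a)%:P.
Let kappa0 a : kappa a != 0.
Proof. by rewrite (frac_eq0 iL) polyC_eq0 (monF_neq0 eK). Qed.
Let kappaD a b : kappa (a + b) = kappa a * kappa b.
Proof. by rewrite /kappa monFD polyCM rmorphM. Qed.

Let iC : {rmorphism K -> L} := i \o polyC.

Lemma derivation_generators_eq0 N (D : L -> L) : derivation id D ->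
  (forall a, tail N a -> D (kappa a) = 0) ->
  (forall k, (k < N.*2)%N -> D (kappa (u k)) = 0) -> D (i 'X) = 0 ->
  forall x, D x = 0.
Proof.
move=> DD Dt Du DX.
have DC : derivation iC (fun x => D (iC x)).
  by split=> x y; rewrite ?rmorphD ?rmorphM ?DD.1 ?DD.2.
pose del a := D (kappa a) / kappa a.
have delD : {morph del : a b / a + b}.
  by move=> a b; rewrite /del kappaD DD.2; field; rewrite !kappa0.
have delz a (z : int) : del a = 0 -> del (a *~ z) = 0.
  move=> da; case: z => n; rewrite ?NegzE ?mulrNz ?(morphDN delD);
    rewrite -pmulrn (morphDMn delD) da mul0rn//.
  by rewrite oppr0.
have Dkappa a : D (kappa a) = 0.
  suff : del a == 0.
    by rewrite mulf_eq0 invr_eq0 (negPf (kappa0 a)) orbF => /eqP.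
  rewrite (head_tail N a) delD (morphD_sum delD) big1 ?add0r; last first.
    by move=> k _; apply: delz; rewrite /del Du ?mul0r.
  by rewrite /del Dt ?mul0r.
apply: (derivation_ratfun_eq0 iL DD) => // a.
exact: (derivation_monF_eq0 eK DC).
Qed.

(** These 2N + 1 derivations of K(x) kill X^a for a in the N-th tail; they are
    dual to u 0, ..., u (2N - 1) and, for the last index, to the variable x. *)
Lemma dual_derivation N (k : 'I_(N.*2.+1)) : exists D : L -> L, [/\
  derivation id D,
  forall a, D (kappa a) = (if (k < N.*2)%N then (l k a)%:~R else 0) * kappa a &
  D (i 'X) = (k == N.*2 :> nat)%:R * i 'X].
Proof.
pose del a : K := if (k < N.*2)%N then (l k a)%:~R else 0.
have [|d dd dE] := @derivation_of_additive _ _ _ eK del.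
  by move=> a b; rewrite /del; case: ifP; rewrite ?addr0// lD intrD.
have [D [DD DC DX]] := ratfun_derivation (k == N.*2 :> nat)%:R dd iL.
exists D; split=> //; last by rewrite DX polyC_natr rmorph_nat.
move=> a.
rewrite DC dE polyCM rmorphM; congr (_ * _).
rewrite /del; case: ifP => _; last by rewrite polyC0 rmorph0.
exact: (rmorph_int iC).
Qed.

(** Let g be the inverse of f. For a in a far tail, g (X^a) is c X^(T a) with
    T additive and T J = J T. Through f and g, the 2N + 1 dual derivations of
    K(x) become derivations of K that kill X^b for b in the image of the tail
    under T. This image is stable under J, so that even_derivations forbids
    the odd number 2N + 1. *)
Lemma no_isomorphism : ~ exists f : {rmorphism K -> L}, bijective f.
Proof.
case=> f /bij_rmorphism[g [fK gK]].
pose theta a := g (kappa a).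
have theta0 a : theta a != 0 by rewrite fmorph_eq0.
have thetaD a b : theta (a + b) = theta a * theta b.
  by rewrite /theta kappaD rmorphM.
have [N1 mono] := character_monomial_tail sepG eK theta0 thetaD hump.
have [T TD TE] := character_exponent eK thetaD (truncD N1)
  (fun a => mono _ (trunc_tail N1 a)).
have [N2 TJ] := tail_lin TD.
(* On the N-th tail theta is monomial and its exponent T commutes with J. *)
pose N := maxn N1 N2.
have thetaE a : tail N a ->
    exists2 c, c != 0 & theta a = cstF e c * monF e (T a).
  move=> aN; have := TE a; rewrite trunc_id//.
  exact: tail_le (leq_maxl _ _) aN.
have {}TJ a : tail N a -> T (J a) = J (T a).
  by move=> aN; apply: TJ; exact: tail_le (leq_maxr _ _) aN.
have /choice[D DP] := @dual_derivation N.
pose y (k : 'I_(N.*2.+1)) : L := if (k < N.*2)%N then kappa (u k) else i 'X.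
have y0 k : y k != 0.
  by rewrite /y; case: ifP => _ //; rewrite (frac_eq0 iL) polyX_eq0.
have Dy k k' : D k (y k') = (k == k')%:R * y k'.
  have [_ Dk DX] := DP k; rewrite /y; case: ifP => k'N.
    rewrite Dk lu; case: ifP => kN.
      by rewrite -(inj_eq val_inj) /=; case: eqP.
    by case: eqP => // kk'; rewrite kk' k'N in kN.
  rewrite DX -(inj_eq val_inj) /=; suff -> : k' = N.*2 :> nat by [].
  by apply/eqP; rewrite eqn_leq -ltnS ltn_ord leqNgt k'N.
have gDf (d : L -> L) : derivation id d -> derivation id (fun x => g (d (f x))).
  move=> [dD dM]; split=> x x'; first by rewrite rmorphD dD rmorphD.
  by rewrite rmorphM dM rmorphD !rmorphM !fK.
have fdg (d : K -> K) : derivation id d -> derivation id (fun x => f (d (g x))).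
  move=> [dD dM]; split=> x x'; first by rewrite rmorphD dD rmorphD.
  by rewrite rmorphM dM rmorphD !rmorphM !gK.
suff : ~~ odd N.*2.+1 by rewrite /= odd_double.
apply: (@even_derivations _ _ _ sepG eK J
  (fun b => exists2 a, tail N a & b = T a)
  N.*2.+1 (fun k => g (y k)) (fun k x => g (D k (f x))) JD JJ).
- by move=> _ [a aN ->]; exists (J a); [exact: tailJ|rewrite TJ].
- by move=> k; apply: gDf; have [] := DP k.
- by move=> k; rewrite fmorph_eq0.
- by move=> k k'; rewrite gK Dy rmorphM rmorph_nat.
- move=> k _ [a aN ->]; have [DD Dk _] := DP k.
  have [c c0 tE] := thetaE a aN.
  have : g (D k (f (theta a))) = 0.
    rewrite gK Dk; case: ifP => kN; last by rewrite mul0r rmorph0.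
    by rewrite (l_tail aN kN) mul0r rmorph0.
  rewrite tE (gDf _ DD).2 (@derivation_cstF _ _ e _ idfun _ c (gDf _ DD)).
  rewrite mul0r add0r => /eqP.
  by rewrite mulf_eq0 (negPf (cstF_neq0 e c0)) => /eqP.
move=> d dd dC dy x; rewrite -[x]fK -[d _]fK.
apply/eqP; rewrite fmorph_eq0; apply/eqP.
apply: (@derivation_generators_eq0 N _ (fdg d dd)).
- move=> a aN; have [c c0 tE] := thetaE a aN.
  rewrite -/(theta a) tE dd.2 (@derivation_cstF _ _ e _ idfun _ c dd).
  rewrite mul0r add0r dC ?mulr0 ?rmorph0//.
  by exists a.
- move=> k kN; have := dy (Ordinal (leqW kN)).
  by rewrite /y /= kN => ->; rewrite rmorph0.
- by have := dy ord_max; rewrite /y /= ltnn => ->; rewrite rmorph0.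
Qed.
End NoIsomorphism.

(** * F and F(x, y) are isomorphic *)

(** Eigenvectors for distinct eigenvalues: D - lam b removes the term of b
    from a relation and multiplies the other terms by nonzero constants. *)
Lemma eigen_independent (G : zmodType) (L : fieldType) (D : L -> L) (h : G -> L)
    (lam : G -> int) (s : seq G) (c : G -> L) :
  [pchar L] =i pred0 ->
  derivation id D -> (forall a, h a != 0) ->
  (forall a, D (h a) = (lam a)%:~R * h a) ->
  uniq s -> {in s &, injective lam} -> (forall a, D (c a) = 0) ->
  \sum_(a <- s) c a * h a = 0 -> forall a, a \in s -> c a = 0.
Proof.
move=> char0 DD h0 Dh; elim: s c => [//|b s IH] c /= /andP[bs us] inj Dc.
rewrite big_cons => sum0.
have Dz (z : int) : D z%:~R = 0.
  have D1 : D 1 = 0 := @derivation1 _ _ idfun D DD.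
  by case: z => n; rewrite ?NegzE ?mulrNz ?(morphDN DD.1);
    rewrite -pmulrn (morphDMn DD.1) D1 mul0rn ?oppr0.
have cs a : a \in s -> c a = 0.
  move=> sa; have lab : (lam a - lam b)%:~R != 0 :> L.
    have : lam a - lam b != 0.
      rewrite subr_eq0; apply: contraNneq bs => /inj <-//.
        by rewrite inE sa orbT.
      exact: mem_head.
    case: (lam a - lam b) => n; rewrite ?NegzE ?mulrNz ?oppr_eq0 -pmulrn.
      by rewrite (pcharf0P _).1.
    by rewrite (pcharf0P _).1.
  apply: (mulfI lab); rewrite mulr0.
  apply: (IH (fun a => (lam a - lam b)%:~R * c a)) => //.
  - by move=> x y xs ys; apply: inj; rewrite inE ?xs ?ys orbT.
  - by move=> x; rewrite DD.2 Dz Dc mul0r mulr0 addr0.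
  have e1 : \sum_(x <- s) c x * h x = - (c b * h b).
    by apply/eqP; rewrite -addr_eq0 addrC sum0.
  have := congr1 D e1; rewrite (morphDN DD.1) DD.2 Dc mul0r add0r Dh.
  rewrite (morphD_sum DD.1) => e2.
  under eq_bigr => x _ do rewrite intrB mulrBl mulrBl.
  rewrite sumrB; apply/eqP; rewrite subr_eq0; apply/eqP.
  transitivity (\sum_(x <- s) D (c x * h x)).
    by apply: eq_bigr => x _; rewrite DD.2 Dc mul0r add0r Dh mulrCA mulrA.
  rewrite e2 mulrCA -mulrN -e1 mulr_sumr.
  by apply: eq_bigr => x _; rewrite mulrA.
move=> a; rewrite inE => /orP[/eqP->|/cs//].
apply: (mulIf (h0 b)); rewrite mul0r -sum0 [X in _ + X]big_seq big1 ?addr0//.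
by move=> x /cs ->; rewrite mul0r.
Qed.

(** For bounded sequences, sg and tau are the two shifts, up and uq are e_0
    and sqrt 2 e_0, p and q are the coordinates of the first entry: G is the
    direct sum of sg G, a copy of G, and of the subgroup Z ^ 2 generated by up
    and uq. *)
Section Isomorphism.
Variables (G : tfZmodType) (sg tau : G -> G) (p q : G -> int) (up uq : G).
Hypotheses (sepG : separated G)
  (sgD : {morph sg : a b / a + b}) (tauD : {morph tau : a b / a + b})
  (pD : {morph p : a b / a + b}) (qD : {morph q : a b / a + b})
  (tau_sg : forall b, tau (sg b) = b) (p_sg : forall b, p (sg b) = 0)
  (q_sg : forall b, q (sg b) = 0)
  (tau_up : tau up = 0) (p_up : p up = 1) (q_up : q up = 0)
  (tau_uq : tau uq = 0) (p_uq : p uq = 0) (q_uq : q uq = 1)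
  (dec : forall a, a = sg (tau a) + up *~ p a + uq *~ q a).
Variables (K : fieldType) (e : {rmorphism grpalg rat G -> K}).
Variables (L : fieldType) (i : {rmorphism {poly {poly K}} -> L}).
Hypotheses (eK : fraction_field e) (iL : fraction_field i).

Let iC : {rmorphism K -> L} := i \o (polyC \o polyC).
Let Y : L := i 'X%:P.
Let X : L := i 'X.

Let X0 : X != 0. Proof. by rewrite (frac_eq0 iL) polyX_eq0. Qed.
Let Y0 : Y != 0. Proof. by rewrite (frac_eq0 iL) polyC_eq0 polyX_eq0. Qed.

(* The first entry of a goes to a monomial in x and y, the others are
   shifted. *)
Let h a : L := iC (monF e (tau a)) * (Y ^ p a * X ^ q a).

Let h0 a : h a != 0.
Proof.
by rewrite mulf_neq0 ?mulf_neq0 ?expfz_neq0// fmorph_eq0 (monF_neq0 eK).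
Qed.

Let hD a b : h (a + b) = h a * h b.
Proof.
rewrite /h tauD pD qD monFD rmorphM !expfzDr//.
by rewrite [X in _ * X = _]mulrACA [LHS]mulrACA.
Qed.

Let h_sg b : h (sg b) = iC (monF e b).
Proof. by rewrite /h tau_sg p_sg q_sg !expr0z !mulr1. Qed.

Let h_up : h up = Y.
Proof.
by rewrite /h tau_up p_up q_up monF0 rmorph1 mul1r expr0z expr1z mulr1.
Qed.

Let h_uq : h uq = X.
Proof. by rewrite /h tau_uq p_uq q_uq monF0 rmorph1 expr0z expr1z !mul1r. Qed.

(** The extension to K(y, x) of the derivation of K attached to lam \o sg,
    with y and x multiplied by lam up and lam uq. *)
Lemma eigen_derivation (lam : G -> int) : {morph lam : a b / a + b} ->
  exists2 D : L -> L, derivation id D &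
    forall a, D (h a) = (lam a)%:~R * h a.
Proof.
move=> lamD.
have [|d dd dE] := @derivation_of_additive _ _ _ eK (fun b => (lam (sg b))%:~R).
  by move=> a b; rewrite sgD lamD intrD.
have dd1 := twisted_poly_der_derivation (lam up)%:~R dd.
have [D [DD DC DX]] := ratfun_derivation (lam uq)%:~R dd1 iL.
exists D => // a.
pose del a := D (h a) / h a.
have delD : {morph del : a b / a + b}.
  by move=> x y; rewrite /del hD DD.2; field; rewrite !h0.
have del_z b (z : int) : del (b *~ z) = del b *~ z.
  case: z => n; first by rewrite -!pmulrn (morphDMn delD).
  by rewrite NegzE !mulrNz (morphDN delD) -!pmulrn (morphDMn delD).
have lam_z b (z : int) : lam (b *~ z) = lam b *~ z.
  case: z => n; first by rewrite -!pmulrn (morphDMn lamD).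
  by rewrite NegzE !mulrNz (morphDN lamD) -!pmulrn (morphDMn lamD).
suff -> : (lam a)%:~R = del a by rewrite /del divfK.
have del_sg b : del (sg b) = (lam (sg b))%:~R.
  rewrite /del h_sg -[iC _]/(i (monF e b)%:P%:P) DC (twisted_poly_derC _ dd) dE.
  rewrite -![i _]/(iC _) rmorphM rmorph_int mulfK//.
  by rewrite fmorph_eq0 (monF_neq0 eK).
have del_up : del up = (lam up)%:~R.
  rewrite /del h_up /Y DC (twisted_poly_derX _ dd) polyCM rmorphM mulfK//.
  by rewrite -[i _]/(iC _) rmorph_int.
have del_uq : del uq = (lam uq)%:~R.
  by rewrite /del h_uq DX mulfK//; exact: (rmorph_int (i \o @polyC {poly K})).
rewrite [in RHS](dec a) !delD !del_z del_sg del_up del_uq.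
by rewrite [in LHS](dec a) !lamD !lam_z !mulrzz !intrD !intrM !mulrzr.
Qed.

(** X^a |-> h a extends to a ring morphism on Q[G], which is injective because
    the h a are eigenvectors of derivations with distinct eigenvalues, hence
    linearly independent over Q. The image of the induced morphism on K is a
    field that contains K, y and x. *)
Lemma field_isomorphism : exists f : {rmorphism K -> L}, bijective f.
Proof.
pose j : {rmorphism rat -> L} := iC \o cstF e.
have charL : [pchar L] =i pred0 by move=> r; rewrite (fmorph_pchar j) pchar_num.
have h00 : h 0 = 1 by apply: (mulIf (h0 0)); rewrite -hD addr0 mul1r.
have [||phi phiE] := @ga_lift _ _ j h.
- exact: h00.
- exact: hD.
have phiM c a : phi (gaMono c a) = j c * h a by rewrite phiE mmap_gaMono.
have phi_eq0 f : phi f = 0 -> f = 0.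
  move=> f0; have [lam lamD lam_s] := separated_seq
    [seq x - y | x <- msupp f, y <- msupp f] sepG.
  have [D DD Dh] := eigen_derivation lamD.
  have lamI : {in (msupp f : seq G) &, injective lam}.
    move=> a b af bf lab; apply/eqP; rewrite -subr_eq0.
    apply: contraT => /lam_s.
    rewrite (morphDB lamD) lab subrr eqxx; apply.
    by apply/allpairsP; exists (a, b).
  have := eigen_independent (c := fun a => j f@_a)
    charL DD h0 Dh (fset_uniq _) lamI.
  have sum0 : mmap j h f = 0 by rewrite -phiE.
  move=> /(_ _ sum0) f_eq0.
  apply/malgP => a; rewrite mcoeff0.
  have [af|/mcoeff_outdom//] := boolP (a \in msupp f).
  apply/eqP; rewrite -(fmorph_eq0 j); apply/eqP/f_eq0 => // b.
  exact: (@derivation_rat _ _ idfun).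
have phi_inj : injective phi.
  move=> f g fg; apply/eqP; rewrite -subr_eq0; apply/eqP/phi_eq0.
  by rewrite rmorphB fg subrr.
have [f fE] := frac_ext eK phi_inj.
have fX a : f (monF e a) = h a by rewrite /monF fE phiM rmorph1 mul1r.
pose im x := exists z, f z = x.
have imD x y : im x -> im y -> im (x + y).
  by move=> [z <-] [t <-]; exists (z + t); rewrite rmorphD.
have imM x y : im x -> im y -> im (x * y).
  by move=> [z <-] [t <-]; exists (z * t); rewrite rmorphM.
have imV x : im x -> im x^-1 by move=> [z <-]; exists z^-1; rewrite fmorphV.
have im0 : im 0 by exists 0; rewrite rmorph0.
have im_e r : im (iC (e r)).
  elim/ga_ind: r => [c a|r1 r2 I1 I2]; last by rewrite !rmorphD; apply: imD.
  rewrite frac_gaMono rmorphM; apply: imM.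
    by exists (cstF e c); rewrite [cstF e c]/(e (gaMono c 0)) fE phiM h00 mulr1.
  by exists (monF e (sg a)); rewrite fX h_sg.
have im_C c : im (iC c).
  have [r [s [s0 ->]]] := eK.2 c; rewrite fmorph_div.
  by apply: imM => //; apply: imV.
have im_1 (r : {poly K}) : im (i r%:P).
  elim/poly_ind: r => [|r c IH]; first by rewrite polyC0 rmorph0.
  rewrite polyCD polyCM rmorphD rmorphM; apply: imD; last exact: im_C.
  by apply: imM => //; exists (monF e up); rewrite fX h_up.
have im_2 (r : {poly {poly K}}) : im (i r).
  elim/poly_ind: r => [|r c IH]; first by rewrite rmorph0.
  rewrite rmorphD rmorphM; apply: imD => //; apply: imM => //.
  by exists (monF e uq); rewrite fX h_uq.
have im_all x : im x.
  by have [r [s [s0 ->]]] := iL.2 x; apply: imM => //; apply: imV.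
have /choice[g gP] := im_all.
by exists f; exists g => // x; apply: (fmorph_inj f); rewrite gP.
Qed.
End Isomorphism.

(** * The theorem *)

Theorem corollary6p2 (R : realType) :
  let F := KQ (bseq_Zsqrt2 R) in
  field_isomorphic F (ratfun2 F) /\ ~ field_isomorphic F (ratfun1 F).
Proof.
move=> F; split.
  exact: (field_isomorphism (@bseq_separated R)
    (@bseq_cons0D R) (@bseq_beheadD R) (@coord1D R 0) (@coord2D R 0)
    (@bseq_cons0K R)
    (fun b => congr1 fst (coord0_cons0 b))
    (fun b => congr1 snd (coord0_cons0 b))
    (@bseq_behead_unit0 R) (congr1 fst (coord_unit R 0 0))
    (congr1 snd (coord_unit R 0 0))
    (@bseq_behead_Junit0 R) (congr1 fst (coord_Junit R 0 0))
    (congr1 snd (coord_Junit R 0 0)) (@bseq_behead_cons R)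
    (@tofrac_fraction_field _) (@tofrac_fraction_field _)).
exact: (no_isomorphism (@bseq_separated R) (@bseqJD R) (@bseqJJ R)
  (@tail_fromJ R) (@tail_from_le R) (@bseq_truncD R) (@bseq_trunc_tail R)
  (@bseq_trunc_id R) (@bseq_gencoordD R) (@bseq_gencoord_gen R)
  (@bseq_gencoord_tail R) (@bseq_gen_tail R) (@discrete_gliding_hump R)
  (@tail_J_linear R) (@tofrac_fraction_field _) (@tofrac_fraction_field _)).
Qed.
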